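(* Suppose that $n$ is a positive integer and that $I=(i_1,\dots,i_k)$ is a composition of length $k$ of $m$, with $k,m\le n$. Then the separation probability $\sigma^I_{(n-1,1),(n-1,1)}$ is given by $$\frac{(n-m)!\prod_{j} i_j!}{n^2\,(n-2)!^2}\Bigl((k-m_1(I))D^{m-1,k}_{n-1}+m_1(I)\,D^{m-1,k-1}_{n-1}+D^{m,k}_{n-1}+\bigl((n+m-2)^2-m\bigr)D^{m,k}_{n-2}+(m-k)(2n+2m-7)\,D^{m-1,k}_{n-2}+\bigl((m-k-2)(m-k)+k-m_1(I)\bigr)D^{m-2,k}_{n-2}\Bigr).$$
   Context: For a composition $I=(i_1,\dots,i_k)$ of $m$ (positive parts), $m_1(I)$ is its number of parts equal to $1$, and $J=(J_1,\dots,J_k)$ is the set partition of $[m]=\{1,\dots,m\}$ into consecutive blocks with $|J_p|=i_p$. For $n\ge m$, a permutation in $\mathfrak{S}_n$ is $I$-separated if none of its cycles contains two elements from different blocks of $J$. For $\lambda,\mu\vdash n$, $\sigma^I_{\lambda,\mu}$ is the probability that the product of two (independent) uniformly distributed permutations of cycle types $\lambda$ and $\mu$, respectively, is $I$-separated. The quantities $D$ are defined by $$D^{m,k}_n=\frac{(n-1)!}{(n+k)\binom{n+m}{m-k}}\left((-1)^{n-m}\binom{n-1}{k-2}+\sum_{r=0}^{m-k}\binom{n+m}{n+k+r}\binom{n+r+1}{m}\right).$$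
   Formalization: The sum over r defining D carries the sign (-1)^r (without it n=3, I=(2) gives 25/9 for a probability equal to 1), and n is at least 3, since for n=1,2 the formula involves undefined terms such as (-1)! or is false. *)

(* Defs.v *)
From mathcomp Require Import all_boot all_order all_fingroup all_algebra.

Set Implicit Arguments.
Unset Strict Implicit.
Unset Printing Implicit Defensive.

Import GRing.Theory.

Local Open Scope nat_scope.

Definition is_composition (I : seq nat) (m : nat) : bool :=
  all (fun i => 0 < i) I && (sumn I == m).

Definition m1 (I : seq nat) : nat := count_mem 1 I.

(* Permutations act on 'I_n = {0, ..., n-1}, so x : 'I_n stands for x + 1 in
   {1, ..., n}. The block of index p (counted from 0) consists of the
   I`_p consecutive elements that follow the first p blocks. *)
Definition block (n : nat) (I : seq nat) (p : 'I_(size I)) : {set 'I_n} :=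
  [set x : 'I_n | sumn (take p I) <= x < sumn (take p.+1 I)].

Definition separated (n : nat) (I : seq nat) (s : 'S_n) : bool :=
  [forall C in porbits s,
     forall x in C, forall y in C, forall p : 'I_(size I), forall q : 'I_(size I),
       (x \in block n p) && (y \in block n q) ==> (p == q)].

(* Fixed points are cycles of length 1, so this is a partition of n. *)
Definition cycle_type (n : nat) (s : 'S_n) : seq nat :=
  sort geq [seq #|C| | C : {set 'I_n} in porbits s].

Definition perms_of_type (n : nat) (lam : seq nat) : {set 'S_n} :=
  [set s : 'S_n | cycle_type s == lam].

Local Open Scope ring_scope.

Definition separation_probability (n : nat) (I lam mu : seq nat) : rat :=
  #|[set st in setX (perms_of_type n lam) (perms_of_type n mu)
      | separated I (st.1 * st.2)%g]|%:R
  / (#|perms_of_type n lam|%:R * #|perms_of_type n mu|%:R).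

(* The binomial coefficient 'C(n - 1, k - 2), which is 0 when k < 2; the
   truncated subtraction on nat would give 1. *)
Definition bin_pred_pred2 (n k : nat) : nat :=
  if (k < 2)%N then 0%N else 'C(n.-1, k - 2).

(* (n - m)! * prod_j i_j! * D m k n / (n - 1)! ^ 2 is the separation probability
   for two n-cycles (Bernardi, Du, Morales, Stanley). This needs the sign
   (-1) ^+ r in the sum: without it the value for I = (2), where every
   permutation is separated, would be (n + 1) / (n - 1) instead of 1.
   Meaningful for 0 < n and k <= m. *)
Definition D (m k n : nat) : rat :=
  (n.-1)`!%:R / ((n + k)%:R * 'C(n + m, m - k)%:R) *
  ((-1) ^ (n%:Z - m%:Z) * (bin_pred_pred2 n k)%:R
   + \sum_(0 <= r < (m - k).+1)
       (-1) ^+ r * 'C(n + m, n + k + r)%:R * 'C(n + r + 1, m)%:R).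

(* Main.v *)
Require Import Defs.
From mathcomp Require Import all_boot all_order all_fingroup all_algebra.
From mathcomp Require Import ring zify.

Set Implicit Arguments.
Unset Strict Implicit.
Unset Printing Implicit Defensive.

Import GRing.Theory Num.Theory.

(** Erasing the two fixed points.  If s and t are (n-1)-cycles fixing the same
    point, erase it and two long cycles on n - 1 points remain.  If s fixes a and
    t fixes b <> a, then s = (b x) s' and t = t' (a y) for long cycles s', t' on the
    n - 2 other points, and the cycles of st are those of s't' with b inserted next
    to x and a next to y.  Summing over the positions x, y expresses everything
    through the separation counts of two long cycles.

    Two long cycles on N points.  Colouring one more point u in all possible ways
    gives f(c) = sum_q f(c, u := q) - (k - 1) f(c, u := new colour), q ranging over
    the k used colours; this is the recurrence satisfied by D, whose
    summation form is proved by creative telescoping.  There remains the case where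
    all points are coloured: the probability that h t is a long cycle, for t a
    random long cycle and h a random colour preserving permutation, is
    1 / (N - k + 1).  More generally, if h fixes R and preserves j colours outside
    R, then all cycles of h t meet R with probability |R| / (N - j).  This follows
    by induction on j: if A is one of the colour classes, condition on the
    part of h outside A and let u be the permutation of C := R + A induced by the
    product.  By a cycle lemma, the permutations of A turning u into a permutation
    all of whose cycles meet R number (|A| - 1)! times the arcs of u from A to R.
    By symmetry all arcs x -> y with x <> y in C are equally likely, so it is enough
    to know the probability that a given x in C is not fixed by u, that is, that
    all cycles meet C - x, and erasing x reduces this to the induction
    hypothesis. *)

(** * The numbers D *)

Section Numbers.
Local Open Scope ring_scope.

Definition D_term (n m k r : nat) : rat :=
  (-1) ^+ r * 'C(n + m, n + k + r)%:R * 'C(n + r + 1, m)%:R.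

Lemma D_term_widen (n m k L : nat) : (k <= m)%N -> (m - k < L)%N ->
  \sum_(0 <= r < L) D_term n m k r = \sum_(0 <= r < (m - k).+1) D_term n m k r.
Proof.
move=> km kL; rewrite (big_cat_nat (n := (m - k).+1)) //=.
rewrite [X in _ + X]big_nat_cond [X in _ + X]big1 ?addr0 // => r.
rewrite andbT => /andP[lr _]; rewrite /D_term bin_small ?mulr0 ?mul0r //.
by rewrite -addnA ltn_add2l -ltn_subLR.
Qed.

(* Zeilberger certificate: (m + k) r times the summand at m + 1. *)
Lemma D_term_telescope (n m k r : nat) :
  (n%:R - m%:R) * (n + m + 1)%:R * D_term n m k r
  - (m + k)%:R * (m%:R + 1 - k%:R) * D_term n m.+1 k r
  + (k%:R - 1) * (n + k)%:R * D_term n m.+1 k.+1 r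
  = (m + k)%:R * (r.+1%:R * D_term n m.+1 k r.+1 - r%:R * D_term n m.+1 k r).
Proof.
rewrite /D_term.
have -> : (n + k.+1 + r = (n + k + r).+1)%N by rewrite addnS addSn.
have -> : (n + k + r.+1 = (n + k + r).+1)%N by rewrite addnS.
have -> : (n + r.+1 + 1 = (n + r + 1).+1)%N by rewrite !addn1 addnS.
have -> : (n + m.+1 = (n + m).+1)%N by rewrite addnS.
(* [E1], [E2] and [E3] relate neighbouring binomials without division, so they stay true where
   binomials vanish. With them the identity becomes polynomial. *)
have E1 : (n + m + 1)%:R * 'C(n + m, n + k + r)%:R
   = (n + k + r).+1%:R * 'C((n + m).+1, (n + k + r).+1)%:R :> rat.
  by rewrite -!natrM addn1 mul_bin_diag.
have E2 : (m%:R + 1 - k%:R - r%:R) * 'C((n + m).+1, n + k + r)%:R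
   = (n + k + r).+1%:R * 'C((n + m).+1, (n + k + r).+1)%:R :> rat.
  rewrite -natrM mul_bin_left natrM; case: (leqP (n + k + r) (n + m).+1) => h.
    by rewrite natrB // !natrD -[(n + m).+1]addn1 !natrD; ring.
  by rewrite bin_small // !mulr0.
have E3 : (m%:R + 1) * 'C(n + r + 1, m.+1)%:R
   = (n%:R + r%:R + 1 - m%:R) * 'C(n + r + 1, m)%:R :> rat.
  rewrite natr1 -natrM mul_bin_left natrM; case: (leqP m (n + r + 1)) => h.
    by rewrite natrB // !natrD.
  by rewrite bin_small // !mulr0.
rewrite [in X in _ = X]binS natrD exprS.
move: E1 E2 E3; set X := ('C(_, _.+1))%:R; set Y := ('C(_, m.+1))%:R.
set Z := ('C(_, m))%:R; set U := ('C(_, _))%:R; set V := ('C(_, _))%:R.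
rewrite -!natr1 !natrD => E1 E2 E3.
apply/eqP; rewrite -subr_eq0; apply/eqP.
transitivity ((-1) ^+ r * ( (n%:R - m%:R) * ((n%:R + m%:R + 1) * U) * Z
  - (m%:R + k%:R) * ((m%:R + 1 - k%:R - r%:R) * V) * Y
  + (k%:R - 1) * (n%:R + k%:R) * X * Y
  + (m%:R + k%:R) * (r%:R + 1) * X * (Y + Z))); first by ring.
rewrite E1 E2.
transitivity ((-1) ^+ r * X *
  (((n%:R - m%:R) * (n%:R + k%:R + r%:R + 1) + (m%:R + k%:R) * (r%:R + 1)) * Z
   - (n%:R + k%:R) * ((m%:R + 1) * Y))); first by ring.
by rewrite E3; ring.
Qed.

Definition D_num (n m k : nat) : rat :=
  (-1) ^ (n%:Z - m%:Z) * (bin_pred_pred2 n k)%:R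
  + \sum_(0 <= r < (m - k).+1) D_term n m k r.

Lemma bin_pred_pred2_rec (n k : nat) : (0 < n)%N ->
  (k%:R - 1) * (bin_pred_pred2 n k.+1)%:R
  = (n%:R + 1 - k%:R) * (bin_pred_pred2 n k)%:R :> rat.
Proof.
case: k => [|[|k]] n0; rewrite /bin_pred_pred2 /= ?mulr0 ?subrr ?mul0r //.
rewrite !subSS !subn0 -[k.+2%:R]natr1 addrK -natrM mul_bin_left natrM.
case: (leqP k n.-1) => h; last by rewrite bin_small // !mulr0.
by rewrite natrB // -[in n%:R](prednK n0) -!natr1; congr (_ * _); ring.
Qed.

(** The two parts of [D_num] satisfy the recurrence separately: the sum by telescoping, the signed
    binomial because (n-m)(n+m+1) + (m+k)(m+1-k) = (n+k)(n+1-k). *)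
Lemma D_num_rec (n m k : nat) : (0 < n)%N -> (k <= m)%N ->
  (n%:R - m%:R) * (n + m + 1)%:R * D_num n m k
  = (m + k)%:R * (m%:R + 1 - k%:R) * D_num n m.+1 k
  - (k%:R - 1) * (n + k)%:R * D_num n m.+1 k.+1.
Proof.
move=> n0 km; rewrite /D_num.
have -> : (-1) ^ (n%:Z - m.+1%:Z) = - (-1) ^ (n%:Z - m%:Z) :> rat.
  rewrite (_ : n%:Z - m%:Z = (n%:Z - m.+1%:Z) + 1%N%:Z); last by rewrite intS; ring.
  by rewrite [in RHS]exprzDr ?unitrN1 // expr1z mulrN1 opprK.
(* All three sums get the common length m - k + 2, at which the boundary term of the telescoping sum
   contains the binomial of n + m + 1 over n + m + 2, hence vanishes. *)
rewrite -(@D_term_widen n m k (m - k).+2) //.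
rewrite -(@D_term_widen n m.+1 k (m - k).+2) ?(leqW km) ?(subSn km) //.
rewrite -(@D_term_widen n m.+1 k.+1 (m - k).+2) ?subSS //.
set e := (-1) ^ _; have B := bin_pred_pred2_rec k n0.
set b := (bin_pred_pred2 n k)%:R in B *; set b1 := (bin_pred_pred2 n k.+1)%:R in B *.
set S0 := \sum_(_ <= _ < _) _; set S1 := \sum_(_ <= _ < _) _.
set S2 := \sum_(_ <= _ < _) _.
have K : (n%:R - m%:R) * (n + m + 1)%:R * S0
   - (m + k)%:R * (m%:R + 1 - k%:R) * S1 + (k%:R - 1) * (n + k)%:R * S2 = 0.
  rewrite /S0 /S1 /S2 !big_distrr /= -sumrB -big_split /=.
  under eq_bigr do rewrite D_term_telescope.
  rewrite -big_distrr /= telescope_sumr // mul0r subr0.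
  rewrite /D_term bin_small ?mulr0 ?mul0r ?mulr0 //.
  by rewrite -addnA ltn_add2l !addnS subnKC.
apply/eqP; rewrite -subr_eq0; apply/eqP; rewrite -[RHS]K.
transitivity ((n%:R - m%:R) * (n + m + 1)%:R * S0
   - (m + k)%:R * (m%:R + 1 - k%:R) * S1 + (k%:R - 1) * (n + k)%:R * S2
   + e * ( ((n%:R - m%:R) * (n + m + 1)%:R + (m + k)%:R * (m%:R + 1 - k%:R)) * b
          - (n + k)%:R * ((k%:R - 1) * b1))); first by ring.
by rewrite B !natrD; ring.
Qed.

(** In this form the recurrence matches the colouring of one more point: the used colours enter with
    total weight m + k, the sum of all i_q + 1, and a new colour with weight 1 - k. *)
Lemma D_rec (n m k : nat) : (0 < n)%N -> (k <= m)%N ->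
  (n%:R - m%:R) * D m k n
  = (m + k)%:R * D m.+1 k n - (k%:R - 1) * D m.+1 k.+1 n.
Proof.
move=> n0 km; have R := D_num_rec n0 km.
rewrite /D -!/(D_num _ _ _).
have W1 : 'C(n + m.+1, m.+1 - k)%:R
    = (n + m + 1)%:R / (m%:R + 1 - k%:R) * 'C(n + m, m - k)%:R :> rat.
  have H : (m%:R + 1 - k%:R) * 'C(n + m.+1, m.+1 - k)%:R
      = (n + m + 1)%:R * 'C(n + m, m - k)%:R :> rat.
    by rewrite natr1 -natrB 1?leqW // -!natrM subSn // addnS -mul_bin_diag addn1.
  have nz : m%:R + 1 - k%:R != 0 :> rat.
    by rewrite natr1 -natrB 1?leqW // subSn // pnatr_eq0.
  by rewrite mulrAC -H mulrAC mulfV ?mul1r.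
have W2 : (n + k.+1)%:R * 'C(n + m.+1, m.+1 - k.+1)%:R
    = (n + m + 1)%:R * 'C(n + m, m - k)%:R :> rat.
  rewrite -!natrM subSS addnS; congr (_%:R).
  rewrite addn1 (addnS n m) [RHS](mul_bin_down (n + m).+1 (m - k)); congr (_ * _)%N.
  by move: km; lia.
rewrite W1 W2.
have nz1 : m%:R + 1 - k%:R != 0 :> rat.
  by rewrite natr1 -natrB 1?leqW // subSn // pnatr_eq0.
have nz2 : (n + m + 1)%:R != 0 :> rat by rewrite addn1 pnatr_eq0.
have nz3 : (n + k)%:R != 0 :> rat by rewrite pnatr_eq0 -lt0n addn_gt0 n0.
have nz4 : 'C(n + m, m - k)%:R != 0 :> rat.
  by rewrite pnatr_eq0 -lt0n bin_gt0 (leq_trans (leq_subr _ _)) ?leq_addl.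
set w := 'C(_, _)%:R in nz4 *; set g := ((n.-1)`!)%:R.
set x := (n + m + 1)%:R in R nz2 *; set y := (n + k)%:R in R nz3 *.
set z := m%:R + 1 - k%:R in R nz1 *.
clear W1 W2; clearbody x y z w g.
transitivity (g / (y * w * x) * ((n%:R - m%:R) * x * D_num n m k)).
  by field; rewrite nz2 nz3 nz4.
by rewrite R; field; rewrite nz1 nz2 nz3 nz4.
Qed.

Lemma D_diag (n m : nat) : (0 < n)%N -> D m m n =
  (n.-1)`!%:R / (n + m)%:R *
  ((-1) ^ (n%:Z - m%:Z) * (bin_pred_pred2 n m)%:R + 'C(n.+1, m)%:R).
Proof.
move=> n0; rewrite /D subnn bin0 mulr1 big_nat1 expr0 mul1r.
by rewrite !addn0 binn mul1r addn1.
Qed.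

(** When the left side of [D_rec] is 0 at m - 1, the recurrence expresses D m k through D m (k+1),
    with the nonzero factor m - 1 + k; vanishing descends from k = m. *)
Lemma D_vanish_step (n m : nat) : (0 < n)%N -> (1 < m)%N -> D m m n = 0 ->
  (forall k, (k < m)%N -> (n%:R - m.-1%:R) * D m.-1 k n = 0) ->
  forall k, (k <= m)%N -> D m k n = 0.
Proof.
case: m => // m n0 m0 Dm H k km.
rewrite -(subKn km); elim: (m.+1 - k)%N (leq_subr k m.+1) => [|j IH] jm.
  by rewrite subn0.
have jm' : (m.+1 - j.+1 <= m)%N by rewrite subSS leq_subr.
have := D_rec n0 jm'; rewrite /= in H; rewrite H ?ltnS //.
rewrite (_ : (m.+1 - j.+1).+1 = m.+1 - j)%N; last by rewrite subnSK.
rewrite IH 1?ltnW // mulr0 subr0 => /esym /eqP; rewrite mulf_eq0 => /orP[|/eqP //].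
by rewrite pnatr_eq0 addn_eq0 -leqn0 leqNgt -ltnS m0.
Qed.

(** On the diagonal the two binomials are both 1 with opposite signs. This zero and the next one
    settle the boundary cases in which more points are coloured than remain after erasing one or
    two. *)
Lemma D_eq0_succ (n k : nat) : (0 < n)%N -> (k <= n.+1)%N -> D n.+1 k n = 0.
Proof.
move=> n0; apply: (@D_vanish_step n n.+1) => //; last first.
  by move=> j _; rewrite /= subrr mul0r.
rewrite D_diag // binn /bin_pred_pred2 ltnS.
rewrite ltnNge n0 /= subSS subn1 binn.
rewrite -[n.+1]addn1 PoszD opprD addNKr.
by rewrite exprN1 invrN1 mulr1 addNr mulr0.
Qed.

Lemma D_eq0_succ2 (n k : nat) : (0 < n)%N -> (k <= n.+2)%N -> D n.+2 k n = 0.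
Proof.
move=> n0; apply: (@D_vanish_step n n.+2) => //; last first.
  by move=> j jn; rewrite /= D_eq0_succ ?mulr0.
rewrite D_diag // bin_small // /bin_pred_pred2 ltnS /= subSS subn1 bin_small.
  by rewrite mulr0 addr0 mulr0.
by rewrite /= prednK.
Qed.

(** The sum is the coefficient of x^(M-p) in (1+x)^M (1+x)^(-N-1). The case p = N stands apart
    because the truncated p - N - 1 would give the binomial 1 instead of 0. The proof uses Pascal's
    rule, by induction on N and L. *)
Lemma alternating_bin_sum (M N p L : nat) : (N < M)%N -> (N <= p)%N ->
  (M < p + L)%N ->
  \sum_(0 <= r < L) (-1) ^+ r * 'C(M, p + r)%:R * 'C(N + r, N)%:R
  = (if p == N then 0 else 'C(M - N.+1, p - N.+1)%:R) :> rat.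
Proof.
elim: N => [|N IHN] in p L *.
  move=> M0 _; elim: L => [|L IHL] in p *.
    rewrite addn0 big_geq // => Mp; rewrite gtn_eqF ?(leq_ltn_trans _ Mp) //.
    by rewrite bin_small // ltn_sub2r // (leq_ltn_trans M0).
  rewrite -addSnnS => /IHL {}IHL; rewrite big_nat_recl // addn0 expr0 !mul1r.
  rewrite bin0 mulr1.
  under eq_bigr => r _ do
    rewrite exprS mulN1r addnS -addSn (bin0 (0 + _.+1)) -(bin0 (0 + r)) !mulNr.
  rewrite sumrN IHL /=; rewrite subSS subn0.
  case: M M0 {IHL} => // M _; rewrite subSS subn0.
  case: p => [|p]; first by rewrite !bin0 subrr.
  by rewrite /= binS natrD subSS subn0 addrC addKr.
elim: L => [|L IHL] in p *.
  rewrite addn0 big_geq // => NM _ Mp; rewrite gtn_eqF ?(ltn_trans NM Mp) //.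
  by rewrite bin_small //; move: NM Mp; lia.
move=> NM Np; rewrite -addSnnS => Mp.
have := IHN p L.+1 (ltnW NM) (ltnW Np); rewrite -addSnnS => /(_ Mp).
rewrite gtn_eqF // => VN; have := IHL p.+1 NM (leqW Np) Mp.
rewrite gtn_eqF // => VS.
under eq_bigr => r _ do rewrite addSn binS natrD mulrDr.
rewrite big_split /= VN.
rewrite big_nat_recl // !addn0 (bin_small (ltnSn N)) mulr0 add0r.
under eq_bigr => r _ do rewrite exprS mulN1r !mulNr addnS -addSn addnS -addSn.
rewrite sumrN VS.
case: (ltngtP p N.+1) Np => // [Np _|-> _].
  rewrite subSS; have -> : (M - N.+1 = (M - N.+2).+1)%N by move: NM; lia.
  have -> : (p - N.+1 = (p - N.+2).+1)%N by move: Np; lia.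
  by rewrite binS natrD addKr.
by rewrite !subnn !bin0 addNr.
Qed.

(** This is the value when all points are coloured, to be matched with the probability 1 / (n - k +
    1) of obtaining a long cycle. *)
Lemma D_full (n k : nat) : (0 < k)%N -> (k <= n)%N ->
  D n k n = (n.-1)`!%:R / (n - k).+1%:R.
Proof.
move=> k0 kn; have n0 := leq_trans k0 kn.
have nz1 : (n + k)%:R != 0 :> rat by rewrite pnatr_eq0 -lt0n addn_gt0 n0.
have nz2 : 'C(n + n, n - k)%:R != 0 :> rat.
  by rewrite pnatr_eq0 -lt0n bin_gt0 (leq_trans (leq_subr _ _)) ?leq_addl.
have E : (n - k).+1%:R * 'C(n + n, (n - k).+1)%:R
    = (n + k)%:R * 'C(n + n, n - k)%:R :> rat.
  by rewrite -!natrM mul_bin_left; congr ((_ * _)%:R); move: kn; lia.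
have -> : D n k n
    = (n.-1)`!%:R / ((n + k)%:R * 'C(n + n, n - k)%:R) * 'C(n + n, (n - k).+1)%:R.
  rewrite /D -/(D_num n n k) /D_num subrr expr0z mul1r; congr (_ * _).
  have h1 : (n < n + n)%N by lia.
  have h2 : (n + n < n + k.-1 + (n - k).+2)%N by move: k0 kn; lia.
  (* With M = 2n, N = n, p = n + k - 1, the terms after the first are those of [D] with opposite
     sign, and the value of the sum is [bin_pred_pred2 n k]. So the bracket in [D] equals the first
     term, the binomial of 2n over n + k - 1. *)
  have := esym (alternating_bin_sum h1 (leq_addr k.-1 n) h2).
  rewrite big_nat_recl // !addn0 binn expr0 mulr1 mul1r.
  rewrite -[X in _ == X]addn0 eqn_add2l.
  have -> : (n + n - n.+1 = n.-1)%N by lia.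
  have -> : (n + k.-1 - n.+1 = k - 2)%N by lia.
  rewrite (_ : (if _ then _ else _) = (bin_pred_pred2 n k)%:R) => [->|].
    rewrite -addrA -big_split /= big1 ?addr0 => [|r _].
      by rewrite -bin_sub; [congr 'C(_, _)%:R|]; lia.
    rewrite exprS (_ : n + k.-1 + r.+1 = n + k + r)%N; last by lia.
    rewrite (_ : n + r.+1 = n + r + 1)%N; last by lia.
    by rewrite /D_term; ring.
  by rewrite /bin_pred_pred2; case: k k0 {kn nz1 nz2 E h2} => [|[|k]].
have := mulf_neq0 nz1 nz2; rewrite -E mulf_eq0 negb_or => /andP[_ nz3].
by rewrite invfM -!mulrA mulVf ?mulr1.
Qed.

(** Here m - k truncates to 0. The case occurs when all points have different colours and two of
    them are erased. *)
Lemma D_eq0_outside (n m k : nat) : (0 < n)%N -> (m < k)%N -> (n.+1 < k)%N -> D m k n = 0.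
Proof.
move=> n0 mk nk; rewrite /D (_ : m - k = 0)%N; last by apply/eqP; rewrite subn_eq0 ltnW.
rewrite big_nat1 addn0 ['C(n + m, n + k)]bin_small ?ltn_add2l // mulr0 mul0r addr0.
rewrite /bin_pred_pred2; case: ifP => _; first by rewrite !mulr0.
by rewrite ['C(n.-1, _)]bin_small ?mulr0 //; move: n0 nk; lia.
Qed.

End Numbers.

(** * Erasing a point from the cycles of a permutation *)

Section Skip.
Local Open Scope group_scope.
Variable T : finType.
Implicit Types (u v w h t : {perm T}) (d x y z : T) (S R A B C : {set T}).

Lemma porbit_trans u x y z :
  y \in porbit u x -> z \in porbit u y -> z \in porbit u x.
Proof. by rewrite -eq_porbit_mem => /eqP ->. Qed.

Lemma porbit_step u x : u x \in porbit u x.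
Proof. exact: (mem_porbit u 1). Qed.

Lemma porbit_ind u x (P : T -> Prop) :
  P x -> (forall z, P z -> P (u z)) -> forall y, y \in porbit u x -> P y.
Proof.
move=> Px Pu y /porbitP[i ->]; elim: i => [|i IH]; first by rewrite expg0 perm1.
by rewrite expgSr permM; apply: Pu.
Qed.

(** This erases d from its cycle: the point sent to d is now sent to [v d], and d becomes fixed. *)
Definition skip v d := v * tperm d (v d).

Lemma skip_id v d : skip v d d = d.
Proof. by rewrite permM tpermR. Qed.

Lemma skipE v d z : z != d -> skip v d z = if v z == d then v d else v z.
Proof.
move=> zd; rewrite permM; case: tpermP => [->|/perm_inj zd'|/eqP/negPf-> //].
  by rewrite eqxx.
by rewrite zd' eqxx in zd.
Qed.

Lemma skip_mull h v d : h d = d -> skip (h * v) d = h * skip v d.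
Proof. by move=> hd; rewrite /skip permM hd mulgA. Qed.

Lemma skip_insert v d y : v d = d -> skip (v * tperm d y) d = v.
Proof. by move=> vd; rewrite /skip permM vd tpermL -mulgA tperm2 mulg1. Qed.

Lemma porbit_skip v d x y : x != d -> y != d ->
  (y \in porbit (skip v d) x) = (y \in porbit v x).
Proof.
move=> xd yd; apply/idP/idP => [H|].
  suff [//] : y \in porbit v x /\ y != d.
  apply: (porbit_ind (P := fun y => y \in porbit v x /\ y != d)) H.
    by rewrite porbit_id.
  move=> z [zx zd]; rewrite skipE //; case: ifPn => [/eqP vz|vz].
    split; first by rewrite -vz; apply: porbit_trans (porbit_trans zx (porbit_step _ _)) (porbit_step _ _).
    by apply/eqP => vd; case/eqP: zd; apply: (@perm_inj _ v); rewrite vz vd.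
  by split=> //; apply: porbit_trans zx (porbit_step _ _).
(* The orbit under v may pass through d, which the erased permutation leaves out; at d the invariant
   speaks of the next point instead. *)
pose P z := if z == d then v d \in porbit (skip v d) x
            else z \in porbit (skip v d) x.
move=> H; suff : P y by rewrite /P (negPf yd).
apply: (porbit_ind (P := P)) H => [|z]; rewrite /P; first by rewrite (negPf xd) porbit_id.
have [->|zd] := eqVneq z d => [H|zx]; first by case: ifP.
have := porbit_trans zx (porbit_step _ _); rewrite skipE //.
by case: ifP.
Qed.

Lemma skip_Sym v S d : v \in Sym S -> d \in S -> skip v d \in Sym (S :\ d).
Proof.
rewrite !inE => vS dS; apply/subsetP => z; rewrite !inE => Hz; apply/andP.
have zd : z != d by apply: contraNneq Hz => ->; rewrite skip_id.
split=> //; apply: contraNT Hz => zS; rewrite skipE // (out_perm vS zS).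
by rewrite (negPf zd).
Qed.

Lemma insert_Sym v S d y : d \in S -> y \in S -> v \in Sym (S :\ d) ->
  v * tperm d y \in Sym S.
Proof.
move=> dS yS; rewrite !inE => vS; apply: perm_onM.
  by apply: subset_trans vS (subsetDl _ _).
by apply: subset_trans (tperm_on d y) _; apply/subsetP => z /set2P[] ->.
Qed.

(** A permutation of S is determined by the image y of d and by what remains after erasing d; y = d
    gives the fixed point. *)
Lemma sum_Sym_insert S d (phi : {perm T} -> nat) : d \in S ->
  (\sum_(h in Sym S) phi h
   = \sum_(h in Sym (S :\ d)) \sum_(y in S) phi (h * tperm d y)%g)%N.
Proof.
move=> dS; rewrite pair_big_dep /=.
rewrite (reindex_onto (fun p : {perm T} * T => p.1 * tperm d p.2)
                      (fun h => (skip h d, h d))) /=.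
  apply: eq_bigl => -[h y] /=; apply/andP/andP => [[hS /eqP[E1 E2]]|[hS yS]].
    split; first by rewrite -[h]E1 skip_Sym.
    by rewrite -E2; move: hS dS; rewrite inE => /perm_closed->.
  have hd : h d = d by move: hS; rewrite inE => /out_perm->; rewrite // !inE eqxx.
  rewrite insert_Sym //; split=> //.
  by rewrite skip_insert // permM hd tpermL.
by move=> h _; rewrite /skip -mulgA tperm2 mulg1.
Qed.

Definition meets u S R := [forall x in S, exists y in R, y \in porbit u x].

Lemma meetsP u S R :
  reflect (forall x, x \in S -> exists2 y, y \in R & y \in porbit u x) (meets u S R).
Proof. exact: 'forall_in_'exists_in_idP. Qed.

Lemma meets_fix u S R d : d \in S -> d \notin R -> u d = d -> meets u S R = false.
Proof.
move=> dS dR ud; apply/negP => /meetsP/(_ d dS)[y yR yd].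
suff E : y = d by rewrite -E yR in dR.
by apply: (porbit_ind (P := fun y => y = d)) yd => // z ->.
Qed.

Lemma meets_skip v S R d : v \in Sym S -> d \in S -> d \notin R -> v d != d ->
  meets v S R = meets (skip v d) (S :\ d) R.
Proof.
move=> vS dS dR vd; apply/meetsP/meetsP => H x; last first.
  have neq z : z \in R -> z != d by move=> zR; apply: contraNneq dR => <-.
  have [-> _|xd xS] := eqVneq x d.
    have [|y yR yx] := H (v d).
      by rewrite !inE vd; move: vS; rewrite inE => /perm_closed->.
    exists y => //; apply: porbit_trans (porbit_step _ _) _.
    by rewrite -(porbit_skip v vd (neq _ yR)).
  have [|y yR yx] := H x; first by rewrite !inE xd.
  by exists y; rewrite // -(porbit_skip v xd (neq _ yR)).
rewrite !inE => /andP[xd xS]; have [y yR yx] := H x xS.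
by exists y; rewrite // porbit_skip //; apply: contraNneq dR => <-.
Qed.

Lemma Sym_id h S d : h \in Sym S -> d \notin S -> h d = d.
Proof. by rewrite inE => /out_perm; apply. Qed.

Lemma Sym_closed h S d : h \in Sym S -> (h d \in S) = (d \in S).
Proof. by rewrite inE => /perm_closed->. Qed.

Lemma SymS S1 S2 h : S1 \subset S2 -> h \in Sym S1 -> h \in Sym S2.
Proof. by rewrite !inE /perm_on => s12 h1; apply: subset_trans s12. Qed.

Lemma SymM S h1 h2 : h1 \in Sym S -> h2 \in Sym S -> h1 * h2 \in Sym S.
Proof. exact: groupM. Qed.

(* The cycles avoiding C are never affected by h; once there is none, erasing the
   elements outside C from the cycles of u one at a time leaves u'. *)
Lemma meets_reduce u S C : C \subset S -> u \in Sym S ->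
  exists2 u', u' \in Sym C & forall h R, h \in Sym C -> R \subset C ->
    meets (h * u) S R = meets u S C && meets (h * u') C R.
Proof.
move: {2}(#|S :\: C|) (erefl #|S :\: C|) => n; elim: n S u => [|n IH] S u nE CS uS.
  have SC : S = C.
    by apply/eqP; rewrite eqEsubset CS andbT -setD_eq0 -cards_eq0 nE.
  rewrite SC in uS *; exists u => // h R _ _.
  rewrite (_ : meets u C C) //; apply/meetsP => x xC.
  by exists x; rewrite ?porbit_id.
have [d] : exists d, d \in S :\: C by apply/set0Pn; rewrite -cards_eq0 nE.
rewrite inE => /andP[dC dS].
have [ud|ud] := eqVneq (u d) d.
  (* The fixed point d is a cycle avoiding C, so both sides are false whatever u' is. *)
  exists 1; first exact: group1.
  move=> h R hC RC; have hd := Sym_id hC dC.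
  rewrite [meets u _ _](@meets_fix _ _ _ d) //.
  rewrite (@meets_fix _ _ _ d) ?permM ?hd //.
  by apply: contra dC; apply: (subsetP RC).
have [|||u' u'C Hu'] := IH (S :\ d) (skip u d).
- apply/eqP; rewrite -eqSS -nE [in X in _ == X](cardsD1 d) !inE dC dS.
  by rewrite add1n eqSS; apply/eqP/eq_card => z; rewrite !inE andbCA.
- by apply/subsetP => z zC; rewrite !inE (subsetP CS) // andbT; apply: contraNneq dC => <-.
- exact: skip_Sym.
exists u' => // h R hC RC; have hd := Sym_id hC dC.
rewrite (@meets_skip u _ _ d) // (@meets_skip _ _ _ d) ?permM ?hd //.
- by rewrite skip_mull // Hu'.
- by apply: SymM uS; apply: SymS hC.
- by apply: contra dC; apply: (subsetP RC).
Qed.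

(** The long cycles on S; for at most one point this is the identity alone. The formulation through
    [meets] makes the lemmas on erasing points applicable. *)
Definition cyc S := [set u in Sym S | [forall x in S, meets u S [set x]]].

Lemma cycP S u : reflect (u \in Sym S /\
    forall x y, x \in S -> y \in S -> y \in porbit u x) (u \in cyc S).
Proof.
apply: (iffP setIdP) => -[uS H]; split=> //.
  move=> x y xS yS; have := forall_inP H y yS => /meetsP/(_ x xS)[z].
  by rewrite inE => /eqP->.
apply/forall_inP => y yS; apply/meetsP => x xS; exists y; rewrite ?set11 //.
exact: H.
Qed.

Lemma cyc_meets S u x : x \in S -> (u \in cyc S) = (u \in Sym S) && meets u S [set x].
Proof.
move=> xS; apply/cycP/andP => -[uS H]; split=> //.
  by apply/meetsP => y yS; exists x; rewrite ?set11 // H.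
have Hx y : y \in S -> x \in porbit u y.
  by move/meetsP: H => H yS; have [z] := H y yS; rewrite inE => /eqP->.
by move=> y z yS zS; apply: porbit_trans (Hx y yS) _; rewrite porbit_sym Hx.
Qed.

Lemma cyc_Sym S u : u \in cyc S -> u \in Sym S.
Proof. by case/cycP. Qed.

Lemma cyc_skip S u d x : x \in S :\ d -> d \in S -> u \in Sym S ->
  (u \in cyc S) = (u d != d) && (skip u d \in cyc (S :\ d)).
Proof.
move=> xSd dS uS; have [xd xS] := setD1P xSd.
rewrite (cyc_meets _ xS) (cyc_meets _ xSd) uS skip_Sym //=.
have [ud|ud] := eqVneq (u d) d; first by rewrite (@meets_fix _ _ _ d) // inE eq_sym.
by rewrite (@meets_skip _ _ _ d) // inE eq_sym.
Qed.

Lemma sum_cyc_insert S d x (phi : {perm T} -> nat) :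
  x \in S :\ d -> d \in S ->
  (\sum_(t in cyc S) phi t
   = \sum_(t in cyc (S :\ d)) \sum_(y in S :\ d) phi (t * tperm d y)%g)%N.
Proof.
move=> xSd dS; have cS : forall t, (t \in cyc S) = (t \in Sym S) && (t \in cyc S).
  by move=> t; case E: (t \in cyc S); rewrite ?andbF // (cyc_Sym E).
rewrite (eq_bigl _ _ cS) big_mkcondr /= (sum_Sym_insert _ dS).
have cSd : forall t, (t \in cyc (S :\ d)) = (t \in Sym (S :\ d)) && (t \in cyc (S :\ d)).
  by move=> t; case E: (t \in cyc (S :\ d)); rewrite ?andbF // (cyc_Sym E).
rewrite [RHS](eq_bigl _ _ cSd) [RHS]big_mkcondr /=.
apply: eq_bigr => h hS; have hd : h d = d by rewrite (Sym_id hS) // !inE eqxx.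
(* The term y = d leaves d fixed, which is no long cycle because S also contains x. *)
rewrite [LHS](bigD1 d) //= tperm1 mulg1 (cyc_skip xSd) ?hd ?eqxx /=; last 2 first.
- by [].
- exact: SymS (subsetDl _ _) hS.
rewrite add0n; case: ifPn => hc; last first.
  rewrite big1 // => y /andP[yS yd].
  rewrite (cyc_skip xSd) ?insert_Sym // permM hd tpermL yd skip_insert //.
  by rewrite (negPf hc).
apply: eq_big => [y|y /andP[yS yd]]; first by rewrite !inE andbC.
by rewrite (cyc_skip xSd) ?insert_Sym // permM hd tpermL yd skip_insert // hc.
Qed.

Lemma card_cyc S : #|cyc S| = (#|S|.-1)`!.
Proof.
move: {2}#|S| (erefl #|S|) => n; elim: n S => [|n IH] S nE.
  rewrite nE; apply/eqP/cards1P; exists 1; apply/setP => u; rewrite !inE.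
  move/eqP: nE; rewrite cards_eq0 => /eqP->.
  apply/andP/eqP => [[/perm_on_id->//]|->]; first by rewrite cards0.
  by split; [exact: perm_on1 | apply/forall_inP => x; rewrite inE].
have [d dS] : exists d, d \in S by apply/set0Pn; rewrite -cards_eq0 nE.
have cS : #|S :\ d| = n by move: nE; rewrite (cardsD1 d) dS => -[].
(* Insertion needs a second point in S, so singletons form another base case. *)
case: n => [|n] in IH nE cS *.
  rewrite nE; apply/eqP/cards1P; exists 1; apply/setP => u.
  have SE : S = [set d].
    by apply/esym/eqP; rewrite eqEcard sub1set dS cards1 nE.
  rewrite !inE; apply/andP/eqP => [[/perm_on_id->//]|->]; first by rewrite nE.
  split; first exact: perm_on1.
  apply/forall_inP => x; rewrite SE inE => /eqP->; apply/meetsP => y /set1P->.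
  by exists d; rewrite ?set11 ?porbit_id.
have [x xS] : exists x, x \in S :\ d by apply/set0Pn; rewrite -cards_eq0 cS.
rewrite -sum1_card (sum_cyc_insert _ xS dS).
under eq_bigr do rewrite sum1_card.
by rewrite sum_nat_const IH // cS nE /= factS mulnC.
Qed.
End Skip.

(** * Pairs of long cycles whose product preserves a colouring *)

Section Meets.
Local Open Scope group_scope.
Variable T : finType.
Implicit Types (u v w h t : {perm T}) (d x y z : T) (S R A B C : {set T}).

(* [skip v x] sends to R as many points of A :\ x as u sends of A, except for
   the arc entering R at [u y] when nothing in A is sent to x. *)
Lemma exits_skip u R A x y (v := tperm x y * u) : x \in A -> y \in A ->
  x \notin R -> u y != x ->
  (\sum_(z in A :\ x) (skip v x z \in R) + (u^-1 x \notin A) * (u y \in R)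
   = \sum_(z in A) (u z \in R))%N.
Proof.
move=> xA yA xR uyx; have vx : v x = u y by rewrite permM tpermL.
have tA z : (tperm x y z \in A) = (z \in A).
  by case: tpermP => // ->; rewrite xA yA.
have -> : (\sum_(z in A) (u z \in R) = \sum_(z in A) (v z \in R))%N.
  rewrite (reindex_inj (@perm_inj _ (tperm x y))) /=.
  by apply: eq_big => [z|z _]; rewrite ?tA // permM.
rewrite [RHS](big_setD1 x) //= vx.
have E : (\sum_(z in A :\ x) (skip v x z \in R) =
          \sum_(z in A :\ x) (v z \in R)
          + (\sum_(z in A :\ x) (v z == x)) * (u y \in R))%N.
  rewrite big_distrl -big_split /=; apply: eq_bigr => z /setD1P[zx _].
  rewrite skipE // vx; case: eqP => [->|_]; last by rewrite mul0n addn0.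
  by rewrite (negPf xR) mul1n.
rewrite E addnAC -addnA [RHS]addnC; congr (_ + _)%N; rewrite -mulnDl.
suff -> : (\sum_(z in A :\ x) (v z == x) = (u^-1 x \in A))%N.
  by case: (_ \in A); rewrite mul1n.
have F z : (v z == x) = (z == tperm x y (u^-1 x)).
  by rewrite permM -(inj_eq (@perm_inj _ u^-1)) permK -{1}[u^-1 x](tpermK x y) (inj_eq perm_inj).
under eq_bigr => z _ do rewrite F.
rewrite -tA -big_mkcondr /=; set p := tperm _ _ _.
have px : p != x by rewrite eq_sym -F vx.
case: (boolP (p \in A)) => pA.
  rewrite (big_pred1 p) // => z; rewrite !inE.
  by case: (eqVneq z p) => [->|_]; rewrite ?px ?pA ?andbF.
by rewrite big1 // => z /andP[/setD1P[_ zA] /eqP zp]; rewrite -zp zA in pA.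
Qed.

(** This is the cycle lemma. Take x in A and write h as h' followed by the transposition of x and y.
    If u y = x, then x becomes a fixed point outside R and nothing is counted; otherwise x is
    erased, and [exits_skip] tells how the number of arcs from A to R changes. *)
Lemma sum_Sym_meets_base R A u : [disjoint R & A] -> A != set0 ->
  u \in Sym (R :|: A) ->
  (\sum_(h in Sym A) meets (h * u)%g (R :|: A) R
   = (#|A|.-1)`! * \sum_(x in A) (u x \in R))%N.
Proof.
move: {2}(#|A|.-1) (erefl #|A|.-1) => n; elim: n R A u => [|n IH] R A u nE dRA A0 uC.
  have /cards1P[x Ax] : #|A| == 1%N by move: A0 nE; rewrite -card_gt0; lia.
  have xR : x \notin R by rewrite (disjointFl dRA) // Ax set11.
  rewrite Ax big_set1 cards1 mul1n in uC *.
  rewrite (big_pred1 1) => [|h]; last first.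
    rewrite inE; apply/idP/eqP => [/perm_on_id->//|->]; first by rewrite cards1.
    exact: perm_on1.
  rewrite mul1g; congr (nat_of_bool _); have xC : x \in R :|: [set x] by rewrite !inE eqxx orbT.
  case: (boolP (u x \in R)) => uxR.
    apply/meetsP => z; rewrite !inE => /orP[zR|/eqP->].
      by exists z => //; apply: porbit_id.
    by exists (u x) => //; apply: porbit_step.
  apply: (@meets_fix _ _ _ _ x) => //; have := Sym_closed x uC.
  by rewrite xC !inE (negPf uxR) => /eqP.
have [x xA] := set0Pn _ A0; have xR : x \notin R by rewrite (disjointFl dRA).
have cA : #|A| = n.+2 by lia.
have cA' : #|A :\ x| = n.+1 by move: cA; rewrite (cardsD1 x) xA => -[].
have CE : (R :|: A) :\ x = R :|: (A :\ x).
  by apply/setP => z; rewrite !inE; case: eqP => // ->; rewrite (negPf xR).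
have xC : x \in R :|: A by rewrite inE xA orbT.
rewrite (sum_Sym_insert _ xA) exchange_big /=.
have step y : y \in A ->
   (\sum_(h in Sym (A :\ x)) meets (h * tperm x y * u)%g (R :|: A) R
    = (u y != x) * (n`! * \sum_(z in A :\ x) (skip (tperm x y * u)%g x z \in R)))%N.
  move=> yA; set v := tperm x y * u.
  have vC : v \in Sym (R :|: A).
    apply: SymM uC; rewrite inE; apply: subset_trans (tperm_on x y) _.
    by apply/subsetP => z /set2P[]->; rewrite inE ?xA ?yA orbT.
  have vx : v x = u y by rewrite permM tpermL.
  have hx h : h \in Sym (A :\ x) -> (h * v) x = u y.
    by move=> hS; rewrite permM (Sym_id hS) ?vx // !inE eqxx.
  case: (boolP (u y == x)) => [/eqP uyx|uyx] /=.
    rewrite mul0n big1 // => h hS; rewrite -mulgA (@meets_fix _ _ _ _ x) //.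
    by rewrite hx.
  have := IH R (A :\ x) (skip v x); rewrite mul1n cA' => <- //.
  - apply: eq_bigr => h hS; rewrite -mulgA -/v (@meets_skip _ _ _ _ x) ?hx //.
      by rewrite CE skip_mull // (Sym_id hS) // !inE eqxx.
    apply: SymM vC; apply: SymS hS; apply/subsetP => z /setD1P[_ zA].
    by rewrite inE zA orbT.
  - by apply: disjointWr dRA; apply: subsetDl.
  - by rewrite -card_gt0 cA'.
  - by rewrite -CE skip_Sym.
rewrite (eq_bigr _ step) cA /=.
under eq_bigr do rewrite mulnCA.
rewrite -big_distrr /= factS [(n.+1 * _)%N]mulnC -mulnA; congr (_ * _)%N.
set E := (\sum_(z in A) (u z \in R))%N.
have ex y : y \in A -> u y != x -> _ := fun yA uyx => exits_skip xA yA xR uyx.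
(* If the predecessor of x lies in A, that one y contributes nothing and each other y contributes
   the full number of arcs. *)
case: (boolP (u^-1 x \in A)) => bA.
  rewrite (big_setD1 (u^-1 x)) //= permKV eqxx mul0n add0n.
  have cU : #|A :\ u^-1 x| = n.+1 by move: cA; rewrite (cardsD1 (u^-1 x)) bA => -[].
  rewrite -cU -sum_nat_const; apply: eq_bigr => y /setD1P[yx yA].
  have uyx : u y != x by rewrite -(inj_eq (@perm_inj _ u^-1)) permK.
  by rewrite /E -(ex y yA uyx) bA mul0n addn0 uyx mul1n.
(* Now every y contributes, but each arc from y to R costs one; the losses add up to [E], so that
   again |A| - 1 times [E] remains. *)
have uyx y : y \in A -> u y != x.
  by move=> yA; apply: contraNneq bA => <-; rewrite permK.
apply/eqP; rewrite -(eqn_add2r E) -mulSnr -cA -sum_nat_const {1}/E -big_split /=.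
apply/eqP; apply: eq_bigr => y yA.
by rewrite uyx // /E -(ex y yA (uyx y yA)) bA !mul1n.
Qed.

(** The only cycle that could avoid the other points of C is z by itself. *)
Lemma meetsD1 u C z : u \in Sym C -> z \in C -> meets u C (C :\ z) = (u z != z).
Proof.
move=> uC zC; have [uz|uz] := eqVneq (u z) z.
  by rewrite (@meets_fix _ _ _ _ z) // !inE eqxx.
apply/meetsP => x xC; have [->|xz] := eqVneq x z; last first.
  by exists x; rewrite ?porbit_id // !inE xz.
by exists (u z); rewrite ?porbit_step // !inE uz (Sym_closed _ uC).
Qed.

(* Averaging over g makes all pairs (g x, g y) of distinct points of C equally
   likely, so that the precise shape of the cycles of u becomes irrelevant. *)
Lemma sum_Sym_meets_conj u S R A : [disjoint R & A] -> R :|: A \subset S ->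
  u \in Sym S -> A != set0 ->
  (#|R :|: A|.-1 * \sum_(g in Sym (R :|: A)) \sum_(h in Sym (g @: A))
       meets (h * u)%g S (g @: R)
  = (#|A|.-1)`! * #|R| *
    \sum_(x in A) \sum_(g in Sym (R :|: A)) meets u S ((R :|: A) :\ g x))%N.
Proof.
move=> dRA; set C := R :|: A => CS uS A0.
have [u' u'C Hu'] := meets_reduce CS uS; set b := meets u S C in Hu'.
have AC : A \subset C by apply: subsetUr.
have RC : R \subset C by apply: subsetUl.
have gC g : g \in Sym C -> g @: C = C by rewrite inE => /im_perm_on.
have gsub g B : g \in Sym C -> B \subset C -> g @: B \subset C.
  by move=> /gC {2}<-; apply: imsetS.
have E1 g x : g \in Sym C -> x \in C -> meets u S (C :\ g x) = b && (u' (g x) != g x).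
  move=> gS xC; have := Hu' 1 (C :\ g x) (group1 _) (subsetDl _ _).
  by rewrite !mul1g => ->; rewrite meetsD1 // (Sym_closed _ gS).
(* By the cycle lemma the inner count is governed by the arcs of u' from g A to g R, written as a
   double sum of indicators over A and R. *)
have E2 g : g \in Sym C -> (\sum_(h in Sym (g @: A)) meets (h * u)%g S (g @: R)
     = b * ((#|A|.-1)`! * \sum_(x in A) \sum_(y in R) (u' (g x) == g y)))%N.
  move=> gS.
  have gRA : g @: R :|: g @: A = C by rewrite -imsetU gC.
  transitivity (\sum_(h in Sym (g @: A)) b * meets (h * u')%g C (g @: R))%N.
    apply: eq_bigr => h hS; rewrite Hu' ?gsub // ?mulnb //.
    by apply: SymS hS; apply: gsub.
  have := @sum_Sym_meets_base (g @: R) (g @: A) u'; rewrite gRA => sb.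
  rewrite -big_distrr /= sb //; last 2 first.
  - by rewrite -setI_eq0 -imsetI ?(disjoint_setI0 dRA) ?imset0 // => ? ? _ _ /perm_inj.
  - by rewrite -card_gt0 card_imset ?card_gt0 //; apply: perm_inj.
  rewrite card_imset; last exact: perm_inj.
  rewrite big_imset /=; last by move=> ? ? _ _ /perm_inj.
  congr (_ * (_ * _))%N; apply: eq_bigr => x xA.
  case: imsetP => [[y yR ->]|nH].
    rewrite (bigD1 y) //= eqxx big1 // => z /andP[_ zy].
    by rewrite (inj_eq perm_inj) eq_sym (negPf zy).
  by rewrite big1 // => y yR; case: eqP => // E; case: nH; exists y.
pose n x y := (\sum_(g in Sym C) (u' (g x) == g y))%N.
have nE x y : x \in C -> y \in C -> x != y ->
    (#|C|.-1 * n x y = \sum_(g in Sym C) (u' (g x) != g x))%N.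
  move=> xC yC xy.
  (* Composing g with the transposition of y and y' keeps g x and exchanges g y with g y'. Summing
     over all y' other than x then counts the g for which u' moves g x. *)
  have nC y' : y' \in C :\ x -> n x y' = n x y.
    move=> /setD1P[y'x y'C]; rewrite /n (reindex_inj (mulgI (tperm y y'))) /=.
    apply: eq_big => [g|g _]; last by rewrite !permM tpermR tpermD // eq_sym.
    rewrite groupMl //= inE; apply: subset_trans (tperm_on y y') _.
    by apply/subsetP => z /set2P[]->.
  have cC : #|C|.-1 = #|C :\ x| by rewrite [in LHS](cardsD1 x) xC.
  rewrite cC -sum_nat_const; under eq_bigr => y' y'C do rewrite -(nC y' y'C).
  rewrite exchange_big /=; apply: eq_bigr => g gS.
  have [E|ne] := eqVneq (u' (g x)) (g x).
    rewrite big1 // => y' /setD1P[y'x _]; rewrite E (inj_eq perm_inj) eq_sym.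
    by rewrite (negPf y'x).
  pose y0 := g^-1 (u' (g x)).
  have gy0 : g y0 = u' (g x) by rewrite permKV.
  have y0C : y0 \in C by rewrite -(Sym_closed _ gS) gy0 (Sym_closed _ u'C) (Sym_closed _ gS).
  rewrite (big_setD1 y0) /= ?gy0 ?eqxx ?big1 //.
    by move=> y' /setD1P[y'y0 _]; rewrite -gy0 (inj_eq perm_inj) eq_sym (negPf y'y0).
  by apply/setD1P; split=> //; apply: contraNneq ne => E; rewrite -gy0 E.
rewrite (eq_bigr _ E2) -!big_distrr /= exchange_big /=.
under eq_bigr do rewrite exchange_big /=.
transitivity (b * (#|A|.-1)`! * (\sum_(x in A) \sum_(y in R) #|C|.-1 * n x y))%N.
  rewrite mulnCA -mulnA; congr (_ * _)%N; rewrite mulnCA; congr (_ * _)%N.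
  by rewrite big_distrr /=; apply: eq_bigr => x _; rewrite big_distrr.
rewrite [(b * _)%N]mulnC -!mulnA; congr (_ * _)%N; rewrite !big_distrr /=.
apply: eq_bigr => x xA; have xC := subsetP AC _ xA.
transitivity (b * (\sum_(y in R) \sum_(g in Sym C) (u' (g x) != g x)))%N.
  congr (_ * _)%N; apply: eq_bigr => y yR.
  have xy : x != y by apply: contraTneq yR => <-; rewrite (disjointFl dRA).
  by rewrite nE // (subsetP RC).
rewrite sum_nat_const mulnCA; congr (_ * _)%N; rewrite big_distrr /=.
by apply: eq_bigr => g gS; rewrite E1 // mulnb.
Qed.

(** * Colour preserving permutations *)

Section Colours.
Variables (K : finType) (c : T -> K).

Definition colperm D := [set h in Sym D | [forall x, c (h x) == c x]].

Lemma colpermP D h :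
  reflect (h \in Sym D /\ forall x, c (h x) = c x) (h \in colperm D).
Proof.
apply: (iffP setIdP) => -[hD H]; split=> //; first by move=> x; apply/eqP/(forallP H).
by apply/forallP => x; apply/eqP.
Qed.

Lemma colperm0 : colperm set0 = [set 1].
Proof.
apply/setP => h; rewrite in_set1; apply/colpermP/eqP => [[]|->]; last first.
  by split; [apply: group1 | move=> x; rewrite perm1].
by rewrite inE => /perm_on_id->; rewrite ?cards0.
Qed.

(** A colour preserving permutation stabilises the class A, so its restriction to A splits off, and
    that restriction is arbitrary. *)
Lemma sum_colperm_split (D : {set T}) q (A := [set x in D | c x == q]) (phi : {perm T} -> nat) :
  (\sum_(h in colperm D) phi h
   = \sum_(h1 in Sym A) \sum_(h2 in colperm (D :\: A)) phi (h1 * h2)%g)%N.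
Proof.
have AP x : reflect (x \in D /\ c x = q) (x \in A).
  by rewrite inE; apply: (iffP andP) => -[? /eqP].
have AD : A \subset D by apply/subsetP => x; case/AP.
rewrite pair_big_dep /=.
rewrite (reindex_onto (fun p : {perm T} * {perm T} => p.1 * p.2)
                      (fun h => (restr_perm A h, (restr_perm A h)^-1 * h))) /=.
  apply: eq_bigl => -[h1 h2] /=; apply/andP/andP => [[/colpermP[hS hc] /eqP[E1 E2]]|].
    have hA : h1 * h2 \in 'N(A | 'P).
      apply/astabsP => x /=; rewrite apermE.
      by rewrite !inE (Sym_closed _ hS) hc.
    have h1A : h1 \in Sym A by rewrite -E1 inE restr_perm_on.
    split=> //; have h2A x : x \in A -> h2 x = x.
      move=> xA; have yA : h1^-1 x \in A by rewrite -(Sym_closed _ h1A) permKV.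
      by have := restr_permE hA yA; rewrite E1 permM permKV.
    have h2N x : x \notin A -> h2 x = (h1 * h2) x by move=> xA; rewrite permM (Sym_id h1A).
    apply/colpermP; split=> [|x]; last first.
      by case: (boolP (x \in A)) => xA; [rewrite h2A | rewrite h2N].
    rewrite inE; apply/subsetP => x; rewrite inE => h2x; rewrite in_setD.
    have xA : x \notin A by apply: contraNN h2x => xA; rewrite h2A.
    by rewrite xA; apply: contraNT h2x => xD; rewrite h2N // (Sym_id hS).
  move=> [h1A /colpermP[h2D h2c]].
  have h1c x : c (h1 x) = c x.
    case: (boolP (x \in A)) => xA; last by rewrite (Sym_id h1A).
    have /AP[_ ->] := xA; by have /AP[_ ->] : h1 x \in A by rewrite (Sym_closed _ h1A).
  have h2A x : x \in A -> h2 x = x by move=> xA; rewrite (Sym_id h2D) // inE xA.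
  have hS : h1 * h2 \in Sym D.
    by apply: SymM; [apply: SymS AD h1A | apply: SymS (subsetDl _ _) h2D].
  have hA : h1 * h2 \in 'N(A | 'P).
    by apply/astabsP => x /=; rewrite apermE !inE (Sym_closed _ hS) permM h2c h1c.
  have E : restr_perm A (h1 * h2) = h1.
    apply/permP => x; case: (boolP (x \in A)) => xA.
      by rewrite restr_permE // permM h2A // (Sym_closed _ h1A).
    by rewrite (out_perm (restr_perm_on _ _) xA) (Sym_id h1A).
  rewrite E mulKg eqxx; split=> //; apply/colpermP; split=> // x.
  by rewrite permM h2c h1c.
by move=> h _; rewrite mulKVg.
Qed.

Lemma card_colperm_split (D : {set T}) q (A := [set x in D | c x == q]) :
  #|colperm D| = (#|A|`! * #|colperm (D :\: A)|)%N.
Proof.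
rewrite -sum1_card (sum_colperm_split _ q) -/A.
under eq_bigr do rewrite sum1_card.
by rewrite sum_nat_const card_Sym.
Qed.

Lemma card_imset_split (D : {set T}) q (A := [set x in D | c x == q]) : A != set0 ->
  #|c @: D| = #|c @: (D :\: A)|.+1.
Proof.
case/set0Pn => x0; rewrite inE => /andP[x0D /eqP cx0].
rewrite (cardsD1 q) -cx0 imset_f //= add1n; congr _.+1; apply: eq_card => z.
rewrite in_setD1; apply/andP/imsetP => [[zq /imsetP[x xD zE]]|[x]].
  by exists x; rewrite // !inE xD -zE -cx0 (negPf zq).
rewrite !inE => /andP[xA xD] ->; rewrite imset_f //; split=> //.
by move: xA; rewrite xD /= cx0.
Qed.

End Colours.
End Meets.

(** * Long cycles multiplied by colour preserving permutations *)

Section CycMeets.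
Local Open Scope group_scope.
Variables (T K : finType) (c : T -> K).
Implicit Types (u v w h t : {perm T}) (d x y z : T) (S R A B C : {set T}).

Lemma meetsJ u S R g : g \in Sym S -> meets (u ^ g) S (g @: R) = meets u S R.
Proof.
move=> gS.
have E x y : (g y \in porbit (u ^ g) (g x)) = (y \in porbit u x).
  have J i z : ((u ^ g) ^+ i) (g z) = g ((u ^+ i) z).
    by elim: i => [|i IH]; rewrite ?expg0 ?perm1 // !expgSr !permM IH permK.
  apply/porbitP/porbitP => -[i H]; exists i; last by rewrite J H.
  by apply: (@perm_inj _ g); rewrite H J.
apply/meetsP/meetsP => H x xS.
  have [|y /imsetP[z zR ->]] := H (g x); first by rewrite (Sym_closed _ gS).
  by rewrite E; exists z.
have [|y yR] := H (g^-1 x); first by rewrite -(Sym_closed _ gS) permKV.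
by rewrite -E permKV; exists (g y); rewrite ?imset_f.
Qed.

Lemma SymJ h A g : (h ^ g \in Sym (g @: A)) = (h \in Sym A).
Proof.
have gI : (g @: A) =i (g^-1 @^-1: A).
  by move=> x; rewrite -{1}[x](permKV g) (mem_imset _ _ perm_inj) inE.
apply/idP/idP; rewrite !inE => /subsetP H; apply/subsetP => x; rewrite inE => Hx.
  have := H (g x); rewrite (mem_imset _ _ perm_inj); apply.
  by rewrite inE permJ (inj_eq perm_inj).
rewrite gI inE; apply: H; rewrite inE; apply: contraNneq Hx => E.
by rewrite -{1}[x](permKV g) permJ E permKV.
Qed.

Lemma cycJ t S g : g \in Sym S -> (t ^ g \in cyc S) = (t \in cyc S).
Proof.
move=> gS; have [->|/set0Pn[x xS]] := eqVneq S set0.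
  rewrite !inE; congr (_ && _).
    by rewrite -[perm_on _ t]inE -[perm_on _ _]inE -(SymJ t set0 g) imset0.
  by apply/forall_inP/forall_inP => _ x; rewrite inE.
rewrite (cyc_meets _ xS) (@cyc_meets _ _ _ (g x)) ?(Sym_closed _ gS) //.
rewrite -[X in (_ ^ g \in Sym X)](im_perm_on (u := g)) ?SymJ; last by rewrite inE in gS.
by rewrite -(meetsJ t _ gS) imset_set1.
Qed.

(** Since h fixes z, erasing z from t leaves a random long cycle on S minus z, and the hypothesis
    applies with one point less; hence |S| - 1 - j in the denominator. *)
Lemma sum_cyc_meets_D1 S C z j : C \subset S -> z \in C -> (1 < #|C|)%N ->
  (forall S R, R \subset S -> R != set0 -> #|c @: (S :\: R)| = j ->
    ((\sum_(t in cyc S) \sum_(h in colperm c (S :\: R)) meets (h * t)%g S R)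
       * (#|S| - j) = #|R| * #|colperm c (S :\: R)| * (#|S|.-1)`!)%N) ->
  #|c @: (S :\: C)| = j ->
  ((\sum_(t in cyc S) \sum_(h in colperm c (S :\: C)) meets (h * t)%g S (C :\ z))
     * (#|S| - j.+1) = #|C|.-1 * #|colperm c (S :\: C)| * (#|S|.-1)`!)%N.
Proof.
move=> CS zC C1 IH jE; have zS := subsetP CS z zC.
have cC : #|C| = #|C :\ z|.+1 by rewrite [LHS](cardsD1 z) zC.
have cS : #|S| = #|S :\ z|.+1 by rewrite [LHS](cardsD1 z) zS.
have [x xCz] : exists x, x \in C :\ z by apply/set0Pn; rewrite -card_gt0; move: C1; rewrite cC.
have DE : (S :\ z) :\: (C :\ z) = S :\: C.
  by apply/setP => y; rewrite !inE; case: eqP => // ->; rewrite zC.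
have xSz : x \in S :\ z by apply: subsetP xCz; apply: setSD.
have := IH (S :\ z) (C :\ z); rewrite DE => {}IH.
rewrite (sum_cyc_insert _ xSz zS).
have -> : (\sum_(t in cyc (S :\ z)) \sum_(y in S :\ z)
     \sum_(h in colperm c (S :\: C)) meets (h * (t * tperm z y))%g S (C :\ z)
   = #|S :\ z| * \sum_(t in cyc (S :\ z)) \sum_(h in colperm c (S :\: C))
        meets (h * t)%g (S :\ z) (C :\ z))%N.
  rewrite exchange_big -sum_nat_const; apply: eq_bigr => y ySz.
  apply: eq_bigr => t tS; apply: eq_bigr => h /colpermP[hS _].
  have [yz yS] := setD1P ySz.
  have hz : h z = z by rewrite (Sym_id hS) // inE zC.
  have tz : t z = z by rewrite (Sym_id (cyc_Sym tS)) // !inE eqxx.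
  rewrite (@meets_skip _ _ _ _ z) ?mulgA ?skip_insert ?permM ?hz ?tz ?tpermL //; last by rewrite !inE eqxx.
  have h1 : h \in Sym (S :\ z).
    by apply: SymS hS; rewrite -DE; apply: subsetDl.
  apply: insert_Sym => //; apply: SymM h1 (cyc_Sym tS).
rewrite cS subSS /= -mulnA IH //; last 2 first.
- exact: setSD.
- by apply/set0Pn; exists x.
rewrite cC /=; have : (0 < #|S :\ z|)%N by apply/card_gt0P; exists x.
by case: #|S :\ z| => // n _; rewrite factS /= mulnCA.
Qed.

(** This is the probability |R| / (N - j) with denominators cleared, by induction on the number j of
    colours outside R. *)
Lemma sum_cyc_meets S R : R \subset S -> R != set0 ->
  ((\sum_(t in cyc S) \sum_(h in colperm c (S :\: R)) meets (h * t)%g S R)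
     * (#|S| - #|c @: (S :\: R)|)
   = #|R| * #|colperm c (S :\: R)| * (#|S|.-1)`!)%N.
Proof.
move: {1 3}(#|c @: (S :\: R)|) (erefl #|c @: (S :\: R)|) => j.
elim: j S R => [|j IH] S R jE RS R0.
  have SR : S = R.
    apply/eqP; rewrite eqEsubset RS andbT -setD_eq0 -(imset_eq0 c).
    by rewrite -cards_eq0 -jE.
  rewrite SR setDv colperm0 cards1 muln1 subn0 mulnC; congr (_ * _)%N.
  rewrite -card_cyc -sum1_card; apply: eq_bigr => t _; rewrite big_set1 mul1g.
  by rewrite (_ : meets t R R) //; apply/meetsP => x xR; exists x; rewrite ?porbit_id.
have [x0 x0D] : exists x, x \in S :\: R.
  by apply/set0Pn; rewrite -(imset_eq0 c) -cards_eq0 -jE.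
pose q := c x0; pose A := [set x in S :\: R | c x == q]; pose C := R :|: A.
have A0 : A != set0 by apply/set0Pn; exists x0; rewrite inE x0D eqxx.
have ASR : A \subset S :\: R by apply/subsetP => x; rewrite inE => /andP[].
have dRA : [disjoint R & A].
  by rewrite disjoint_sym disjoints_subset; apply: subset_trans ASR _; rewrite setDE subsetIr.
have CS : C \subset S by rewrite subUset RS (subset_trans ASR (subsetDl _ _)).
have DE : (S :\: R) :\: A = S :\: C by rewrite setDDl.
have jE' : j = #|c @: (S :\: C)|.
  by apply/eqP; rewrite -eqSS jE (card_imset_split (q := q)) // DE.
have cC : #|C| = (#|R| + #|A|)%N by rewrite cardsU disjoint_setI0 // cards0 subn0.
have Rp : (0 < #|R|)%N by rewrite card_gt0.
have Ap : (0 < #|A|)%N by rewrite card_gt0.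
rewrite (card_colperm_split c (S :\: R) q) -/A DE.
set H := colperm c (S :\: C).
(* [Z g] is the count with R and A moved by g. Conjugation of t and h1 by g shows that it equals
   [Z 1]; h commutes with g, since g moves only points of C and h only points outside C. So the
   count may be averaged over g. *)
pose Z (g : {perm T}) := (\sum_(t in cyc S) \sum_(h in H) \sum_(h1 in Sym (g @: A))
     meets (h1 * (h * t))%g S (g @: R))%N.
have Z1 : (\sum_(t in cyc S) \sum_(h in colperm c (S :\: R)) meets (h * t)%g S R
    = Z 1%g)%N.
  apply: eq_bigr => t _; rewrite (sum_colperm_split _ _ q) -/A DE exchange_big /=.
  apply: eq_bigr => h _; have im1 B : (1%g : {perm T}) @: B = B.
    by rewrite (eq_imset (g := id)) ?imset_id // => x; rewrite perm1.
  by rewrite !im1; apply: eq_bigr => h1 _; rewrite mulgA.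
have ZJ g : g \in Sym C -> Z g = Z 1.
  move=> gC; have gS : g \in Sym S by apply: SymS gC.
  rewrite -Z1 /Z (reindex_inj (conjg_inj g)) /=.
  apply: eq_big => [t|t _]; first by rewrite cycJ.
  rewrite [RHS](sum_colperm_split _ _ q) -/A DE [RHS]exchange_big /=.
  apply: eq_bigr => h /colpermP[hD _].
  rewrite (reindex_inj (conjg_inj g)) /=; apply: eq_big => [h1|h1 _]; first by rewrite SymJ.
  have hg : h ^ g = h.
    apply/conjg_fixP/commgP/(perm_onC (S1 := S :\: C) (S2 := C)).
    - by rewrite inE in hD.
    - by rewrite inE in gC.
    by rewrite -setI_eq0 setDE -setIA [~: C :&: C]setIC setICr setI0.
  by rewrite -{1}hg -!conjMg meetsJ // mulgA.
have C1 : (1 < #|C|)%N by rewrite cC -addn1 leq_add.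
have D1 z : z \in C ->
    ((\sum_(t in cyc S) \sum_(h in H) meets (h * t)%g S (C :\ z)) * (#|S| - j.+1)
     = #|C|.-1 * #|H| * (#|S|.-1)`!)%N.
  move=> zC; apply: sum_cyc_meets_D1 => // S' R' R'S' R'0 E.
  by have := IH S' R' (esym E) R'S' R'0.
(* Sum [Z g] over all g in Sym C and apply [sum_Sym_meets_conj] to each product of h and t. *)
have key : (#|C|.-1 * (#|C|`! * Z 1%g) = (#|A|.-1)`! * #|R| *
   \sum_(x in A) \sum_(g in Sym C) \sum_(t in cyc S) \sum_(h in H)
      meets (h * t)%g S (C :\ g x))%N.
  rewrite -card_Sym -sum_nat_const.
  under eq_bigr => g gC do rewrite -(ZJ g gC).
  transitivity (\sum_(t in cyc S) \sum_(h in H) (#|C|.-1 * \sum_(g in Sym C)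
      \sum_(h1 in Sym (g @: A)) meets (h1 * (h * t))%g S (g @: R)))%N.
    rewrite exchange_big big_distrr /=; apply: eq_bigr => t _.
    by rewrite exchange_big big_distrr.
  under eq_bigr => t tS.
    under eq_bigr => h /colpermP[hS _].
      rewrite sum_Sym_meets_conj //; last first.
        by apply: SymM (cyc_Sym tS); apply: SymS hS; apply: subsetDl.
      over.
    rewrite -big_distrr /=; over.
  rewrite -big_distrr /=; congr (_ * _)%N.
  under eq_bigr do rewrite exchange_big /=.
  rewrite exchange_big /=; apply: eq_bigr => x xA.
  under eq_bigr do rewrite exchange_big /=.
  by rewrite exchange_big.
rewrite Z1; have Cp : (0 < #|C|.-1 * #|C|`!)%N.
  by rewrite muln_gt0 fact_gt0 andbT -subn1 subn_gt0.
apply/eqP; rewrite -(eqn_pmul2l Cp) mulnA -[(_ * Z 1%g)%N]mulnA key; apply/eqP.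
rewrite -mulnA big_distrl /=.
transitivity ((#|A|.-1)`! * #|R| * (\sum_(x in A) \sum_(g in Sym C)
    (#|C|.-1 * #|H| * (#|S|.-1)`!)))%N.
  congr (_ * _)%N; apply: eq_bigr => x xA; rewrite big_distrl /=.
  apply: eq_bigr => g gC; apply: D1; rewrite (Sym_closed _ gC).
  by rewrite inE xA orbT.
rewrite !sum_nat_const card_Sym -[in RHS](prednK Ap) factS (prednK Ap).
by ring.
Qed.

(** Let R be one colour class. Given the part of h outside R, the permutations of R that complete
    the product to a long cycle exist only if all cycles meet R; then they number (|R| - 1)!, as
    they correspond to the long cycles on R. The rest is [sum_cyc_meets] with k - 1 colours. *)
Lemma sum_cyc_cyc S : S != set0 ->
  ((\sum_(t in cyc S) \sum_(h in colperm c S) (h * t \in cyc S)%g)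
     * (#|S| - #|c @: S|).+1 = #|colperm c S| * (#|S|.-1)`!)%N.
Proof.
case/set0Pn => x xS; pose R := [set y in S | c y == c x].
have xR : x \in R by rewrite inE xS eqxx.
have R0 : R != set0 by apply/set0Pn; exists x.
have RS : R \subset S by apply/subsetP => y; rewrite inE => /andP[].
have Rp : (0 < #|R|)%N by rewrite card_gt0.
rewrite (card_colperm_split c S (c x)) -/R (card_imset_split (q := c x)) // -/R.
have F u : u \in Sym S ->
    (\sum_(h in Sym R) (h * u \in cyc S)%g = (#|R|.-1)`! * meets u S R)%N.
  move=> uS; have [u' u'R Hu'] := meets_reduce RS uS.
  transitivity (\sum_(h in Sym R) meets u S R * (h * u' \in cyc R)%g)%N.
    apply: eq_bigr => h hR; rewrite (cyc_meets _ xS) (cyc_meets _ xR).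
    rewrite !groupM ?(SymS RS hR) //= Hu' ?mulnb //.
    by apply/subsetP => y /set1P->.
  rewrite -big_distrr /= mulnC; congr (_ * _)%N.
  rewrite -card_cyc -sum1_card (reindex_inj (mulIg u'^-1)) /=.
  rewrite [RHS]big_mkcond [LHS]big_mkcond; apply: eq_bigr => v _.
  rewrite groupMr ?groupV //= mulgKV.
  by case E: (v \in cyc R); rewrite ?(cyc_Sym E) // if_same.
have -> : (\sum_(t in cyc S) \sum_(h in colperm c S) (h * t \in cyc S)%g
  = (#|R|.-1)`! * \sum_(t in cyc S) \sum_(h in colperm c (S :\: R)) meets (h * t)%g S R)%N.
  rewrite big_distrr /=; apply: eq_bigr => t tS.
  rewrite (sum_colperm_split _ _ (c x)) -/R exchange_big big_distrr /=.
  apply: eq_bigr => h /colpermP[hS _]; rewrite -F.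
    by apply: eq_bigr => h1 _; rewrite mulgA.
  by apply: SymM (cyc_Sym tS); apply: SymS hS; apply: subsetDl.
have := sum_cyc_meets RS R0.
have -> : ((#|S| - #|c @: (S :\: R)|.+1).+1 = #|S| - #|c @: (S :\: R)|)%N.
  rewrite subnSK //; apply: leq_ltn_trans (leq_imset_card _ _) _.
  by rewrite -[ltnRHS](cardsID R S) (setIidPr RS) -[ltnLHS]add0n ltn_add2r.
move=> E; rewrite -mulnA E -[in RHS](prednK Rp) factS (prednK Rp); ring.
Qed.
End CycMeets.

(** * Separation by products of two long cycles *)

Lemma card_colperm (T K : finType) (c : T -> K) (D : {set T}) :
  #|colperm c D| = (\prod_(q : K) #|[set x in D | c x == q]|`!)%N.
Proof.
move: {2}#|c @: D| (erefl #|c @: D|) => n; elim: n D => [|n IH] D nE.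
  have -> : D = set0 by apply/eqP; rewrite -(imset_eq0 c) -cards_eq0 nE.
  rewrite colperm0 cards1 big1 // => q _.
  by rewrite (_ : [set _ in _ | _] = set0) ?cards0 //; apply/setP => x; rewrite !inE.
have [q] : exists q, q \in c @: D by apply/set0Pn; rewrite -cards_eq0 nE.
case/imsetP => x0 x0D qE; set A := fun q => [set x in D | c x == q].
have A0 : A q != set0 by apply/set0Pn; exists x0; rewrite inE x0D qE eqxx.
rewrite (card_colperm_split c D q) IH; last first.
  by apply/eqP; rewrite -eqSS -(card_imset_split A0) nE.
rewrite [RHS](bigD1 q) //=; congr (_ * _)%N; rewrite (bigD1 q) //=.
rewrite (_ : [set _ in _ | _] = set0) ?cards0 ?mul1n; last first.
  by apply/setP => x; rewrite !inE; case: (x \in D); case: (c x == q); rewrite ?andbF.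
apply: eq_bigr => q' q'q; congr (_`!); apply: eq_card => x; rewrite !inE.
by case: (c x =P q') => [->|]; rewrite ?andbF // (negPf q'q) andbF.
Qed.

Section Profile.
Variable Q : finType.
Implicit Types (i j : Q -> nat) (q : Q).

Definition nonzero i := #|[set q | (0 < i q)%N]|.

Lemma nonzero_le i : (nonzero i <= \sum_q i q)%N.
Proof.
rewrite /nonzero -sum1_card big_mkcond /=; apply: leq_sum => q _.
by rewrite inE; case: (i q).
Qed.

Variables (i j : Q -> nat) (q : Q).
Hypothesis ji : forall q', j q' = (i q' + (q' == q))%N.

Lemma sum_incr : (\sum_q' j q' = (\sum_q' i q').+1)%N.
Proof.
under eq_bigr do rewrite ji.
by rewrite big_split /= -big_mkcond big_pred1_eq addn1.
Qed.

Lemma prod_incr : (\prod_q' (j q')`! = (i q).+1 * \prod_q' (i q')`!)%N.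
Proof.
rewrite (bigD1 q) // [in RHS](bigD1 q) //= ji eqxx addn1 factS mulnA; congr (_ * _)%N.
by apply: eq_bigr => q' /negPf q'q; rewrite ji q'q addn0.
Qed.

Lemma nonzero_incr : nonzero j = (nonzero i + (i q == 0))%N.
Proof.
rewrite /nonzero (cardsD1 q) [in RHS](cardsD1 q) !inE ji eqxx addn1 /=.
have -> : #|[set q' | (0 < j q')%N] :\ q| = #|[set q' | (0 < i q')%N] :\ q|.
  apply: eq_card => q'; rewrite !inE ji; case: (q' == q) => //=.
  by rewrite addn0.
by case: (i q) => [|n]; rewrite ?addn0 // addnC.
Qed.
End Profile.

Section Separation.
Local Open Scope group_scope.
Variable T : finType.
Implicit Types (c : T -> option T) (u s t : {perm T}) (x y q : T) (S : {set T}).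

Definition sep c u := [forall x, forall y in porbit u x,
  (c x != None) && (c y != None) ==> (c x == c y)].

Lemma sepP c u : reflect (forall x y, y \in porbit u x -> c x != None ->
   c y != None -> c x = c y) (sep c u).
Proof.
apply: (iffP forallP) => H x.
  by move=> y yx cx cy; have /forall_inP/(_ y yx) := H x; rewrite cx cy => /eqP.
by apply/forall_inP => y yx; apply/implyP => /andP[cx cy]; apply/eqP/H.
Qed.

Definition recolour c x q := fun z => if z == x then Some q else c z.

Definition profile c S q := #|[set x in S | c x == Some q]|.

Lemma sep_recolour c u x q : c x = None -> sep (recolour c x q) u
  = sep c u && [forall y in porbit u x, (c y == None) || (c y == Some q)].
Proof.
move=> cx; apply/sepP/andP => [H|[/sepP H /forall_inP Hq] y z].
  split.
    apply/sepP => y z zy cy cz; have := H y z zy; rewrite /recolour.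
    have -> : (y == x) = false by apply: contraNF cy => /eqP->; rewrite cx.
    have -> : (z == x) = false by apply: contraNF cz => /eqP->; rewrite cx.
    by apply.
  apply/forall_inP => y yx; case: eqVneq => //= cy.
  have := H x y yx; rewrite /recolour eqxx.
  have -> : (y == x) = false by apply: contraNF cy => /eqP->; rewrite cx.
  by move=> <-.
rewrite /recolour; case: (eqVneq y x) => [->|yx]; case: (eqVneq z x) => [->|zx] // zy cy cz.
- by have := Hq z zy; rewrite (negPf cz) => /eqP.
- by have := Hq y; rewrite porbit_sym => /(_ zy); rewrite (negPf cy) => /eqP.
exact: H.
Qed.

Lemma profile_recolour c S x q q' : x \in S -> c x = None ->
  profile (recolour c x q) S q' = (profile c S q' + (q' == q))%N.
Proof.
move=> xS cx; rewrite /profile (cardsD1 x) [in RHS](cardsD1 x) !inE xS cx /recolour eqxx.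
rewrite add0n addnC /=; congr (_ + _)%N; last by rewrite eq_sym.
by apply: eq_card => z; rewrite !inE; case: eqP.
Qed.

Lemma sum_sep_recolour c u S x q0 : u \in Sym S -> x \in S -> c x = None ->
  profile c S q0 = 0%N ->
  (sep c u + nonzero (profile c S) * sep (recolour c x q0) u
   = \sum_(q | 0 < profile c S q) sep (recolour c x q) u + sep (recolour c x q0) u)%N.
Proof.
move=> uS xS cx q00; under eq_bigr do rewrite sep_recolour //.
rewrite sep_recolour //; case: (boolP (sep c u)) => [/sepP Hs|_] /=; last by rewrite muln0 big1.
have pS y : y \in porbit u x -> y \in S.
  apply: (porbit_ind (P := fun y => y \in S)) => // z.
  by rewrite (Sym_closed _ uS).
have [H|[y yx cy]] : (forall y, y \in porbit u x -> c y = None) \/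
    exists2 y, y \in porbit u x & c y != None.
  case: (boolP [forall y in porbit u x, c y == None]) => [/forall_inP H|].
    by left=> y /H /eqP.
  by rewrite negb_forall => /existsP[y]; rewrite negb_imply => /andP[yx cy]; right; exists y.
  have E q : [forall y in porbit u x, (c y == None) || (c y == Some q)].
    by apply/forall_inP => y yx; rewrite H.
  rewrite E muln1 addnC; under eq_bigr do rewrite E; congr (_ + _)%N.
  by rewrite sum1dep_card.
case E: (c y) cy => [p|] // _.
have pp : (0 < profile c S p)%N.
  by apply/card_gt0P; exists y; rewrite !inE pS // E eqxx.
have F q : [forall y in porbit u x, (c y == None) || (c y == Some q)] = (q == p).
  apply/forall_inP/eqP => [/(_ y yx)|-> z zx].
    by rewrite E /= => /eqP[].
  case: eqVneq => //= cz; rewrite -E eq_sym; apply/eqP; apply: Hs; rewrite ?E //.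
  by apply: porbit_trans zx; rewrite porbit_sym.
have -> : [forall y in porbit u x, (c y == None) || (c y == Some q0)] = false.
  by rewrite F; apply: contraTF pp => /eqP <-; rewrite q00.
rewrite muln0 !addn0; under eq_bigr do rewrite F.
by rewrite (bigD1 p) //= eqxx big1 // => q /andP[_ /negPf->].
Qed.

Lemma sum_profile c S : (\sum_q profile c S q = #|[set x in S | c x != None]|)%N.
Proof.
rewrite -sum1dep_card [RHS](partition_big (fun x => odflt x (c x)) predT) //=.
apply: eq_bigr => q _; rewrite /profile -sum1dep_card; apply: eq_bigl => x.
by case: (c x) => [p|]; rewrite /= ?andbF // andbT.
Qed.

Lemma cycV t S : (t^-1 \in cyc S) = (t \in cyc S).
Proof.
by apply/cycP/cycP => -[tS H]; split; rewrite ?groupV // in tS *;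
  move=> x y xS yS; have := H x y xS yS; rewrite porbitV.
Qed.

(** The claimed number of pairs of long cycles on N points with separated product, when i q points
    have colour q. *)
Definition Phi N (i : T -> nat) : rat :=
  (((N - \sum_q i q)`! * \prod_q (i q)`!)%N%:R * D (\sum_q i q)%N (nonzero i) N)%R.

Lemma sum_sep_full c S : S != set0 -> (forall x, x \in S -> c x != None) ->
  ((\sum_(s in cyc S) \sum_(t in cyc S) sep c (s * t)%g)%N%:R
  = Phi #|S| (profile c S) :> rat)%R.
Proof.
move=> S0 cS.
have mE : (\sum_q profile c S q = #|S|)%N.
  rewrite sum_profile; apply: eq_card => x; rewrite inE.
  by case: (boolP (x \in S)) => // /cS ->.
have kE : #|c @: S| = nonzero (profile c S).
  have SI : injective (@Some T) by move=> ? ? [].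
  rewrite /nonzero -(card_imset _ SI); apply: eq_card => p.
  apply/imsetP/imsetP => -[x]; last first.
    by rewrite inE => /card_gt0P[y]; rewrite inE => /andP[yS /eqP cy] ->; exists y.
  move=> xS ->; case E: (c x) (cS x xS) => [q|] // _; exists q => //.
  by rewrite inE; apply/card_gt0P; exists x; rewrite inE xS E eqxx.
have pE : #|colperm c S| = (\prod_q (profile c S q)`!)%N.
  rewrite card_colperm (bigD1 None) //= (_ : [set _ in _ | _] = set0); last first.
    by apply/setP => x; rewrite !inE; case: (boolP (x \in S)) => // /cS /negPf.
  rewrite cards0 mul1n (reindex_omap Some id) /=; last by case.
  by apply: eq_big => // q; rewrite eqxx.
have SN : (0 < #|S|)%N by rewrite card_gt0.
have kS : (nonzero (profile c S) <= #|S|)%N by rewrite -mE nonzero_le.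
have k0 : (0 < nonzero (profile c S))%N by rewrite -kE card_gt0 imset_eq0.
rewrite /Phi mE subnn mul1n D_full // -pE.
have := sum_cyc_cyc c S0; rewrite kE => H.
(* Replace t by its inverse and put h = s * t^-1. As all points are coloured, h is separated exactly
   when it preserves colours, and s = h * t. *)
have -> : (\sum_(s in cyc S) \sum_(t in cyc S) sep c (s * t)%g
   = \sum_(t in cyc S) \sum_(h in colperm c S) (h * t \in cyc S)%g)%N.
  rewrite exchange_big (reindex_inj invg_inj) /=.
  apply: eq_big => [t|t]; rewrite cycV // => tS.
  rewrite big_mkcond [RHS]big_mkcond [RHS](reindex_inj (mulIg t^-1)) /=.
  apply: eq_bigr => s _; rewrite mulgKV.
  case: (boolP (s \in cyc S)) => sS; last by rewrite if_same.
  rewrite (_ : sep c (s * t^-1) = (s * t^-1 \in colperm c S)); first by case: ifP.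
  have stS : s * t^-1 \in Sym S by rewrite groupM ?groupV ?cyc_Sym.
  apply/sepP/colpermP => [Hs|[_ Hc] x y].
    split=> // x; case: (boolP (x \in S)) => xS; last by rewrite (Sym_id stS).
    apply/esym/Hs; rewrite ?porbit_step ?cS //.
    by rewrite (Sym_closed _ stS).
  move=> yx _ _; apply: (porbit_ind (P := fun y => c x = c y)) yx => // z ->.
  by rewrite Hc.
apply: (@mulIf _ (#|S| - nonzero (profile c S)).+1%:R%R); first by rewrite pnatr_eq0.
by rewrite -natrM H natrM mulrA divfK // pnatr_eq0.
Qed.

Lemma Phi_incr N (i j : T -> nat) q : (forall q', j q' = (i q' + (q' == q))%N) ->
  (Phi N j = ((N - (\sum_q i q).+1)`! * \prod_q (i q)`!)%N%:R * (i q).+1%:R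
     * D (\sum_q i q).+1 (nonzero i + (i q == 0%N))%N N)%R.
Proof.
move=> ji; rewrite /Phi (sum_incr ji) (prod_incr ji) (nonzero_incr ji).
by rewrite mulnCA mulnC natrM.
Qed.

(** Induction on the number of uncoloured points: [sum_sep_recolour], summed over s and t, is the
    same recurrence as [D_rec]. *)
Lemma sum_sep c S : S != set0 ->
  ((\sum_(s in cyc S) \sum_(t in cyc S) sep c (s * t)%g)%N%:R
  = Phi #|S| (profile c S) :> rat)%R.
Proof.
move=> S0; have N0 : (0 < #|S|)%N by rewrite card_gt0.
move: {2}#|[set x in S | c x == None]| (erefl #|[set x in S | c x == None]|) => n.
elim: n c => [|n IH] c nE.
  apply: sum_sep_full => // x xS; apply: contra_eqN nE => cx.
  by rewrite -lt0n; apply/card_gt0P; exists x; rewrite inE xS cx.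
have [x] : exists x, x \in [set x in S | c x == None].
  by apply/set0Pn; rewrite -cards_eq0 nE.
rewrite inE => /andP[xS /eqP cx]; set i := profile c S.
have mN : (#|S| = \sum_q i q + n.+1)%N.
  rewrite sum_profile -nE -(cardsID [set x | c x == None] S) addnC.
  by congr (_ + _)%N; apply: eq_card => y; rewrite !inE // andbC.
have IHq q : ((\sum_(s in cyc S) \sum_(t in cyc S) sep (recolour c x q) (s * t)%g)%N%:R
    = Phi #|S| (profile (recolour c x q) S) :> rat)%R.
  apply: IH; apply/eqP; rewrite -eqSS -nE [X in _ == X](cardsD1 x) inE xS cx eqxx add1n eqSS.
  apply/eqP; apply: eq_card => y; rewrite !inE /recolour.
  by case: (y == x); rewrite ?andbF.
have PhiE q := Phi_incr #|S| (fun q' => profile_recolour q q' xS cx).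
have [q0 q00] : exists q0, i q0 = 0%N.
  have : (nonzero i < #|T|)%N.
    apply: leq_ltn_trans (nonzero_le i) _; apply: leq_trans (max_card (mem S)).
    by rewrite mN addnS ltnS leq_addr.
  rewrite /nonzero -(cardsC [set q | (0 < i q)%N]) -[X in (X < _)%N]addn0 ltn_add2l.
  case/card_gt0P => q0; rewrite !inE -leqNgt leqn0 => /eqP; by exists q0.
have key : ((\sum_(s in cyc S) \sum_(t in cyc S) sep c (s * t)%g)
   + nonzero i * (\sum_(s in cyc S) \sum_(t in cyc S) sep (recolour c x q0) (s * t)%g)
  = \sum_(q | 0 < i q) (\sum_(s in cyc S) \sum_(t in cyc S) sep (recolour c x q) (s * t)%g)
   + (\sum_(s in cyc S) \sum_(t in cyc S) sep (recolour c x q0) (s * t)%g))%N.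
  rewrite [X in (_ = X + _)%N]exchange_big big_distrr -!big_split /=.
  apply: eq_bigr => s sS; rewrite [X in (_ = X + _)%N]exchange_big big_distrr -!big_split /=.
  apply: eq_bigr => t tS; apply: sum_sep_recolour => //.
  by apply: SymM; apply: cyc_Sym.
have E : ((\sum_(s in cyc S) \sum_(t in cyc S) sep c (s * t)%g)%N%:R
    + (nonzero i)%:R * Phi #|S| (profile (recolour c x q0) S)
  = (\sum_(q | (0 < i q)%N) Phi #|S| (profile (recolour c x q) S))
    + Phi #|S| (profile (recolour c x q0) S) :> rat)%R.
  rewrite -IHq -natrM -natrD key natrD natr_sum; congr (_ + _)%R.
  by apply: eq_bigr => q _; rewrite IHq.
(* Giving x the used colour q multiplies the product of factorials by i q + 1, which produces the
   coefficient m + k of [D_rec]. *)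
have nE1 : (\sum_(q | 0 < i q) (i q).+1 = \sum_q i q + nonzero i)%N.
  under eq_bigr do rewrite -addn1; rewrite big_split /= sum1dep_card; congr (_ + _)%N.
  rewrite big_mkcond; apply: eq_bigr => q _; by case: (i q).
set d1 := D (\sum_q i q).+1 (nonzero i) #|S|.
set d2 := D (\sum_q i q).+1 (nonzero i).+1 #|S|.
set F := ((#|S| - (\sum_q i q).+1)`! * \prod_q (i q)`!)%N%:R%R : rat.
have sE : (\sum_(q | (0 < i q)%N) Phi #|S| (profile (recolour c x q) S)
     = F * (\sum_q i q + nonzero i)%N%:R * d1)%R.
  rewrite -nE1 natr_sum mulr_sumr mulr_suml; apply: eq_bigr => q q1.
  by rewrite PhiE -/i eqn0Ngt q1 addn0.
have R := D_rec N0 (nonzero_le i).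
rewrite -/d1 -/d2 in R.
move: E; rewrite sE PhiE -/i q00 eqxx addn1 mulr1 -/d2 -/F => E.
have FE : (((#|S| - \sum_q i q)`! * \prod_q (i q)`!)%N%:R
    = F * (#|S|%:R - (\sum_q i q)%:R))%R.
  have mle : (\sum_q i q <= #|S|)%N by rewrite mN leq_addr.
  have E1 : (#|S| - \sum_q i q = n.+1)%N by rewrite mN addKn.
  by rewrite /F -natrB // subnS E1 /= -natrM factS; congr (_%:R)%R; ring.
rewrite /Phi FE -mulrA R -/i.
apply/eqP; rewrite -(inj_eq (addIr ((nonzero i)%:R * (F * d2))%R)) E.
by apply/eqP; ring.
Qed.
End Separation.

(** * Products of two cycles missing one point each *)

Section Insert.
Local Open Scope group_scope.
Variable T : finType.
Implicit Types (c : T -> option T) (u s t w : {perm T}) (a b x y q : T) (S : {set T}).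

Lemma sepV c u : sep c u^-1 = sep c u.
Proof. by apply/sepP/sepP => H x y; have := H x y; rewrite porbitV. Qed.

Lemma porbit_fix u a y : u a = a -> y \in porbit u a -> y = a.
Proof. by move=> ua; apply: (porbit_ind (P := fun y => y = a)) => // z ->. Qed.

(** In the product a stands immediately before y in its cycle, so the only new condition compares
    the colour of a with those on the cycle of y. *)
Lemma sep_insert c u a y : u a = a -> y != a -> sep c (u * tperm a y)
  = sep c u && (if c a is Some q
                then [forall z in porbit u y, (c z == None) || (c z == Some q)]
                else true).
Proof.
move=> ua ya; set v := u * tperm a y.
have va : v a = y by rewrite permM ua tpermL.
have vu x z : x != a -> z != a -> (z \in porbit v x) = (z \in porbit u x).
  by move=> xa za; rewrite -(porbit_skip v xa za) skip_insert.
have vaz z : z != a -> (z \in porbit v a) = (z \in porbit u y).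
  by move=> za; rewrite -(vu y z) // -(porbit_perm v 1) expg1 va.
have uaz z : z != a -> (z \in porbit u a) = false.
  by move=> za; apply: contraNF za => /(porbit_fix ua) ->.
apply/sepP/andP => [H|[/sepP H H'] x z].
  split.
    apply/sepP => x z; have [->|xa] := eqVneq x a.
      by move=> /(porbit_fix ua) ->.
    have [->|za] := eqVneq z a; first by rewrite porbit_sym uaz.
    by rewrite -vu //; apply: H.
  case ca : (c a) => [q|] //; apply/forall_inP => z zy; case: eqVneq => //= cz.
  have [->|za] := eqVneq z a; first by rewrite ca.
  by rewrite -ca eq_sym; apply/eqP/H; rewrite ?vaz // ca.
have [->|xa] := eqVneq x a; have [->|za] := eqVneq z a => //.
- rewrite vaz //; case ca : (c a) H' => [q|] // /forall_inP H' zy _ cz.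
  by have := H' z zy; rewrite (negPf cz) => /eqP.
- rewrite porbit_sym vaz //; case ca : (c a) H' => [q|] // /forall_inP H' xy cx _.
  by have := H' x xy; rewrite (negPf cx) => /eqP.
by rewrite vu //; apply: H.
Qed.

(** If y is uncoloured, placing a point of colour q next to y imposes the same condition as giving y
    the colour q; if y is coloured, its colour must be q. *)
Lemma sum_sep_insert c u a S : u a = a -> a \notin S ->
  (\sum_(y in S) sep c (u * tperm a y)%g
   = if c a is Some q then profile c S q * sep c u
        + \sum_(y in S | c y == None) sep (recolour c y q) u
     else #|S| * sep c u)%N.
Proof.
move=> ua aS; have ya y : y \in S -> y != a by apply: contraTneq => ->.
under eq_bigr => y yS do rewrite sep_insert ?ya //.
case ca: (c a) => [q|]; last by under eq_bigr do rewrite andbT; rewrite sum_nat_const.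
rewrite (bigID (fun y => c y == None)) /= addnC; congr (_ + _)%N; last first.
  by apply: eq_bigr => y /andP[yS /eqP cy]; rewrite sep_recolour.
rewrite /profile -sum1dep_card big_distrl /= [LHS]big_mkcond [RHS]big_mkcond /=.
apply: eq_bigr => y _; case yS : (y \in S) => //=.
case cy : (c y) => [p|] //=; rewrite mul1n.
case: (boolP (sep c u)) => [/sepP H|_]; last by rewrite if_same.
rewrite andTb; have -> : (Some p == Some q) = (p == q) by [].
case: (eqVneq p q) => [pq|pq].
  rewrite (_ : [forall _ in _, _]) //; apply/forall_inP => z zy.
  by case: eqVneq => //= cz; rewrite -pq -cy eq_sym; apply/eqP/H; rewrite ?cy.
rewrite (_ : [forall _ in _, _] = false) //; apply/negP => /forall_inP/(_ y).
by rewrite porbit_id cy /= => /(_ isT) /eqP[E]; rewrite E eqxx in pq.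
Qed.

Lemma sum_cyc_insertl S d x (phi : {perm T} -> nat) : x \in S :\ d -> d \in S ->
  (\sum_(s in cyc S) phi s
   = \sum_(s in cyc (S :\ d)) \sum_(y in S :\ d) phi (tperm d y * s)%g)%N.
Proof.
move=> xSd dS; rewrite (reindex_inj invg_inj) /=.
rewrite (eq_bigl (fun s => s \in cyc S)) => [|s]; last exact: cycV.
rewrite (sum_cyc_insert _ xSd dS) [RHS](reindex_inj invg_inj) /=.
apply: eq_big => [s|s _]; first by rewrite cycV.
by apply: eq_bigr => y _; rewrite invMg tpermV.
Qed.

(* The effect on a quantity f depending on the colouring of S of inserting, next to
   each point of S in turn, a point of colour o. *)
Definition insertion S (o : option T) (f : (T -> option T) -> nat) c : nat :=
  if o is Some q then profile c S q * f c + \sum_(y in S | c y == None) f (recolour c y q)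
  else #|S| * f c.

Lemma sum_insertion S o c (I : finType) (P : pred I) (F : I -> (T -> option T) -> nat) :
  (\sum_(i | P i) insertion S o (F i) c = insertion S o (fun c' => \sum_(i | P i) F i c') c)%N.
Proof.
case: o => [q|] /=; last by rewrite big_distrr.
by rewrite big_split big_distrr /= exchange_big.
Qed.

Lemma eq_insertion S o f g c :
  (forall c', (forall z, z \notin S -> c' z = c z) -> f c' = g c') ->
  insertion S o f c = insertion S o g c.
Proof.
move=> fg; case: o => [q|] /=; rewrite fg //; congr (_ + _)%N.
apply: eq_bigr => y /andP[yS _]; apply: fg => z zS; rewrite /recolour.
by case: eqP => // zy; rewrite zy yS in zS.
Qed.

Lemma sum_sep_insert2 c s t a b S : a != b -> a \notin S -> b \notin S ->
  s \in Sym S -> t \in Sym S ->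
  (\sum_(x in S) \sum_(y in S) sep c (tperm b x * s * (t * tperm a y))%g
   = insertion S (c b) (insertion S (c a) (fun c' => sep c' (s * t)%g)) c)%N.
Proof.
move=> ab aS bS sS tS; rewrite exchange_big /=.
(* The point b is inserted from the left. Inversion moves its transposition to the right and
   preserves separation. *)
have inS o y : \sum_(x in S) sep o (tperm b x * s * (t * tperm a y))%g
   = \sum_(x in S) sep o ((s * (t * tperm a y))^-1 * tperm b x)%g.
  by apply: eq_bigr => x _; rewrite -sepV -mulgA invMg tpermV.
transitivity (\sum_(y in S) insertion S (c b) (fun c' => sep c' (s * t * tperm a y)%g) c)%N.
  apply: eq_bigr => y yS; rewrite inS sum_sep_insert //; last first.
    apply: (@perm_inj _ (s * (t * tperm a y))); rewrite permKV !permM.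
    rewrite (Sym_id sS) // (Sym_id tS) // tpermD //.
    by apply: contraNneq bS => <-.
  rewrite /insertion sepV mulgA; case: (c b) => // q; congr (_ + _)%N.
  by apply: eq_bigr => x _; rewrite sepV.
(* Only points of S have been recoloured, so a keeps its colour. *)
rewrite sum_insertion; apply: eq_insertion => c' c'S.
rewrite sum_sep_insert // ?permM ?(Sym_id sS) ?(Sym_id tS) // c'S //.
Qed.

Definition sep_count S c : nat := \sum_(s in cyc S) \sum_(t in cyc S) sep c (s * t)%g.

Lemma sep_count_neq c a b : a != b -> (2 < #|T|)%N -> let S := ~: [set a; b] in
  (\sum_(s in cyc (~: [set a])) \sum_(t in cyc (~: [set b])) sep c (s * t)%g
   = insertion S (c b) (insertion S (c a) (sep_count S)) c)%N.
Proof.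
move=> ab T2 S.
have Sa : (~: [set a]) :\ b = S by apply/setP => x; rewrite !inE negb_or andbC.
have Sb : (~: [set b]) :\ a = S by apply/setP => x; rewrite !inE negb_or.
have aS : a \notin S by rewrite !inE eqxx.
have bS : b \notin S by rewrite !inE eqxx orbT.
have [x0 x0S] : exists x, x \in S.
  by apply/card_gt0P; have := cardsC [set a; b]; rewrite cards2 ab -/S; move: T2; lia.
rewrite (@sum_cyc_insertl _ b x0) ?Sa //; last by rewrite !inE eq_sym.
transitivity (\sum_(s in cyc S) \sum_(t in cyc S) insertion S (c b)
    (insertion S (c a) (fun c' => sep c' (s * t)%g)) c)%N.
  apply: eq_bigr => s sS; rewrite exchange_big /=.
  rewrite (@sum_cyc_insert _ _ a x0) ?Sb //; last by rewrite !inE.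
  apply: eq_bigr => t tS; rewrite -sum_sep_insert2 ?cyc_Sym // exchange_big /=.
  by apply: eq_bigr => y yS; apply: eq_bigr => x xS; rewrite !mulgA.
under eq_bigr do rewrite sum_insertion.
rewrite sum_insertion; apply: eq_insertion => c' _.
under eq_bigr do rewrite sum_insertion.
by rewrite sum_insertion.
Qed.
End Insert.

Local Open Scope ring_scope.

(** * Evaluating the insertions through D *)

Section Evaluate.
Variable T : finType.
Implicit Types (c : T -> option T) (a b x y q : T) (S : {set T}) (i j : T -> nat).

Definition weight N i : rat := ((N - \sum_q i q)`! * \prod_q (i q)`!)%N%:R.

(* Truncated subtraction breaks the factorial recursion at m = n + 1, where D vanishes. *)
Lemma fact_mul_D n m k : (0 < n)%N -> (m <= n.+1)%N -> (k <= m)%N ->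
  (n.+1 - m)%N%:R * ((n - m)`!%:R * D m k n) = (n.+1 - m)`!%:R * D m k n.
Proof.
move=> n0; rewrite leq_eqVlt => /predU1P[->|mn] km.
  by rewrite D_eq0_succ // !mulr0.
by rewrite (@subSn m n mn) factS natrM mulrA.
Qed.

Lemma sum_uncoloured (f : T -> nat) c S v :
  (forall y, y \in S -> c y = None -> (f y)%:R = v :> rat) ->
  (\sum_(y in S | c y == None) f y)%N%:R = (#|S| - \sum_q profile c S q)%N%:R * v.
Proof.
move=> H; rewrite natr_sum.
rewrite (eq_bigr (fun=> v)) => [|y /andP[yS /eqP cy]]; last exact: H.
rewrite big_const iter_addr addr0 -[LHS]mulr_natl; congr (_%:R * _).
rewrite sum_profile -(cardsID [set x | c x == None] S).
have -> : #|S :\: [set x | c x == None]| = #|[set x in S | c x != None]|.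
  by apply: eq_card => x; rewrite !inE andbC.
by rewrite addnK; apply: eq_card => x; rewrite !inE.
Qed.

Lemma profile_sum_le c S : (\sum_q profile c S q <= #|S|)%N.
Proof. by rewrite sum_profile subset_leq_card //; apply/subsetP => x; rewrite inE => /andP[]. Qed.

Lemma insertion1 c S q : S != set0 ->
  let i := profile c S in let m := (\sum_q i q)%N in
  let k := (nonzero i + (i q == 0))%N in
  (insertion S (Some q) (sep_count S) c)%:R
  = weight #|S| i * ((i q)%:R * D m k #|S| + (i q).+1%:R * D m.+1 k #|S|).
Proof.
move=> S0 i m k; have N0 : (0 < #|S|)%N by rewrite card_gt0.
have mN : (m <= #|S|)%N := profile_sum_le c S.
have km : (k <= m.+1)%N.
  by rewrite -addn1 leq_add ?nonzero_le // leq_b1.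
rewrite /= natrD natrM sum_sep // -/i.
rewrite (@sum_uncoloured _ _ _ (Phi #|S| (fun q' => i q' + (q' == q))%N)); last first.
  move=> y yS cy; rewrite sum_sep //.
  have E := fun q' => profile_recolour q q' yS cy.
  by rewrite (Phi_incr _ E) (@Phi_incr T #|S| i (fun q' => i q' + (q' == q))%N q).
rewrite (@Phi_incr T #|S| i (fun q' => i q' + (q' == q))%N q) // -/i -/m -/k.
have -> : (i q)%:R * Phi #|S| i = (i q)%:R * (weight #|S| i * D m k #|S|).
  rewrite /Phi -/m /k; case: eqP => [->|_]; first by rewrite !mul0r.
  by rewrite addn0.
have F := fact_mul_D N0 (mN : m.+1 <= _.+1)%N km; rewrite subSS in F.
rewrite /weight -/m !natrM.
transitivity ((i q)%:R * ((#|S| - m)`!%:R * (\prod_q0 (i q0)`!)%N%:R * D m k #|S|)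
   + (\prod_q0 (i q0)`!)%N%:R * (i q).+1%:R *
     ((#|S| - m)%N%:R * ((#|S| - m.+1)`!%:R * D m.+1 k #|S|))); first by ring.
by rewrite F; ring.
Qed.

(** [jq] is the number of points of colour q once one more point has received the colour q'; k
    counts the colours present after both insertions. As before, terms with a smaller number of
    colours have coefficient 0. *)
Lemma insertion2 c S q q' : S != set0 ->
  let i := profile c S in let m := (\sum_q i q)%N in
  let jq := (i q + (q == q'))%N in
  let k := (nonzero i + (i q' == 0) + (jq == 0))%N in
  (insertion S (Some q') (insertion S (Some q) (sep_count S)) c)%:R
  = weight #|S| i * ((i q')%:R * (i q)%:R * D m k #|S|
     + ((i q')%:R * (i q).+1%:R + (i q').+1%:R * jq%:R) * D m.+1 k #|S|
     + (i q').+1%:R * jq.+1%:R * D m.+2 k #|S|).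
Proof.
move=> S0 i m jq k; have N0 : (0 < #|S|)%N by rewrite card_gt0.
have mN : (m <= #|S|)%N := profile_sum_le c S.
have km : (k <= m.+2)%N.
  by rewrite -addn1 -[m.+1]addn1 !leq_add ?nonzero_le ?leq_b1.
rewrite /insertion -/(insertion S (Some q) (sep_count S) c) natrD natrM.
rewrite -/i insertion1 // -/i -/m.
rewrite (@sum_uncoloured _ _ _ ((#|S| - m.+1)`!%:R * (\prod_q (i q)`!)%N%:R
   * (i q').+1%:R * (jq%:R * D m.+1 k #|S| + jq.+1%:R * D m.+2 k #|S|))); last first.
  move=> y yS cy; rewrite -/(insertion S (Some q) (sep_count S) _) insertion1 //.
  have E := fun q0 => profile_recolour q' q0 yS cy; rewrite -/i in E.
  rewrite /weight (sum_incr E) (prod_incr E) (nonzero_incr E) E.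
  by rewrite -/jq -/m -/k !natrM; ring.
have -> : (i q')%:R * (weight #|S| i * ((i q)%:R * D m (nonzero i + (i q == 0)) #|S|
      + (i q).+1%:R * D m.+1 (nonzero i + (i q == 0)) #|S|))
   = (i q')%:R * (weight #|S| i * ((i q)%:R * D m k #|S|
      + (i q).+1%:R * D m.+1 k #|S|)).
  have [->|iq'] := eqVneq (i q') 0%N; first by rewrite !mul0r.
  congr (_ * (_ * _)); rewrite /k /jq (negPf iq') addn0.
  have [qq'|qq'] := eqVneq q q'; last by rewrite addn0.
  by rewrite qq' (negPf iq') addn1 addn0.
have F1 : (#|S| - m)%N%:R * ((#|S| - m.+1)`!%:R * (jq%:R * D m.+1 k #|S|))
    = (#|S| - m)`!%:R * (jq%:R * D m.+1 k #|S|).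
  have [->|jq0] := eqVneq jq 0%N; first by rewrite !mul0r !mulr0.
  have km1 : (k <= m.+1)%N.
    by rewrite /k (negPf jq0) addn0 -addn1 leq_add ?nonzero_le ?leq_b1.
  have F := fact_mul_D N0 (mN : m.+1 <= _.+1)%N km1; rewrite subSS in F.
  by rewrite [RHS]mulrCA -F; ring.
have F2 : (#|S| - m)%N%:R * ((#|S| - m.+1)`!%:R * D m.+2 k #|S|)
    = (#|S| - m)`!%:R * D m.+2 k #|S|.
  move: mN; rewrite leq_eqVlt => /predU1P[mE|mlt].
    by rewrite [in D _ _ _]mE D_eq0_succ2 ?mulr0 // -mE.
  by rewrite -(subnSK mlt) factS natrM mulrA.
rewrite /weight -/m !natrM; set P := (\prod_q0 _)%N%:R.
transitivity ((i q')%:R * ((#|S| - m)`!%:R * P * ((i q)%:R * D m k #|S|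
      + (i q).+1%:R * D m.+1 k #|S|))
  + P * (i q').+1%:R * ((#|S| - m)%N%:R * ((#|S| - m.+1)`!%:R * (jq%:R * D m.+1 k #|S|)))
  + P * (i q').+1%:R * jq.+1%:R * ((#|S| - m)%N%:R * ((#|S| - m.+1)`!%:R * D m.+2 k #|S|))).
  by ring.
by rewrite F1 F2; ring.
Qed.

(** * Summation over the two fixed points *)

Section Totals.
Variable c : T -> option T.
Let n := #|T|.
Hypothesis n2 : (2 < n)%N.
Let I := profile c [set: T].
Let m := (\sum_q I q)%N.
Let k := nonzero I.
Let A : rat := weight n I.

Lemma sum_by_colour (phi : option T -> rat) :
  \sum_x phi (c x) = (n - m)%N%:R * phi None + \sum_q (I q)%:R * phi (Some q).
Proof.
rewrite (partition_big c predT) //= (bigD1 None) //=; congr (_ + _).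
  rewrite (eq_bigr (fun=> phi None)) => [|x /eqP-> //].
  rewrite big_const iter_addr addr0 -[LHS]mulr_natl; congr (_%:R * _).
  rewrite /m sum_profile /n -(cardsC [set x | c x == None]) -[RHS]addnBA.
    rewrite (_ : ~: _ = [set x in [set: T] | c x != None]) ?subnn ?addn0.
      by apply: eq_card => x; rewrite !inE.
    by apply/setP => x; rewrite !inE.
  by apply: subset_leq_card; apply/subsetP => x; rewrite !inE.
rewrite (reindex_omap Some id) /=; last by case.
apply: eq_big => [q|q _]; first by rewrite eqxx.
rewrite (eq_bigr (fun=> phi (Some q))) => [|x /eqP-> //].
rewrite big_const iter_addr addr0 -[LHS]mulr_natl; congr (_%:R * _).
by apply: eq_card => x; rewrite !inE.
Qed.

Lemma profile_remove S x q : x \in S ->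
  profile c S q = (profile c (S :\ x) q + (c x == Some q))%N.
Proof.
move=> xS; rewrite /profile (cardsD1 x) inE xS addnC; congr (_ + _)%N.
by apply: eq_card => y; rewrite !inE andbA.
Qed.

Lemma eq_Phi N i j : i =1 j -> Phi N i = Phi N j.
Proof.
move=> ij; have E1 : (\sum_q i q = \sum_q j q)%N by apply: eq_bigr.
have E2 : (\prod_q (i q)`! = \prod_q (j q)`!)%N by apply: eq_bigr => q _; rewrite ij.
have E3 : nonzero i = nonzero j by apply: eq_card => q; rewrite !inE ij.
by rewrite /Phi E1 E2 E3.
Qed.

Lemma m_le : (m <= n)%N.
Proof. by rewrite -[n]cardsT profile_sum_le. Qed.

Lemma uncoloured_lt a : c a = None -> (m < n)%N.
Proof.
move=> ca; rewrite /m sum_profile /n -cardsT; apply: proper_card.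
by apply/properP; split; [apply/subsetP => x; rewrite !inE | exists a; rewrite !inE ?ca].
Qed.

(** The common fixed point a is erased. For a of colour q the weight becomes A / I q, which the I q
    choices of a compensate; the colour itself disappears if I q = 1. *)
Lemma sum_sep_eq : (\sum_a sep_count (~: [set a]) c)%N%:R
  = A * (D m k (n - 1) + \sum_(q | (0 < I q)%N) D (m - 1) (k - (I q == 1))%N (n - 1)).
Proof.
pose phi o := if o is Some q
  then A * D (m - 1) (k - (I q == 1))%N (n - 1) / (I q)%:R else Phi (n - 1) I.
rewrite natr_sum (eq_bigr (fun a => phi (c a))) => [|a _]; last first.
  have cS : #|~: [set a]| = (n - 1)%N by rewrite cardsCs setCK cards1.
  rewrite sum_sep ?cS; last by rewrite -card_gt0 cS; move: n2; lia.
  have E q := profile_remove q (in_setT a); rewrite -/I setTD in E.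
  case ca : (c a) => [q|] /=; last first.
    by apply: eq_Phi => q; rewrite E ca addn0.
  have {}E q' : I q' = (profile c (~: [set a]) q' + (q' == q))%N.
    by rewrite E ca [q' == q]eq_sym.
  set i := profile c _ in E *.
  have Iq : I q = (i q).+1 by rewrite E eqxx addn1.
  have mi : m = (\sum_q i q).+1 := sum_incr E.
  rewrite /Phi /A /weight -/m (prod_incr E) mi /k (nonzero_incr E) Iq subSS subn0.
  rewrite eqSS addnK -subSS subn1 prednK; last by move: n2; lia.
  by rewrite !natrM; field; rewrite ?natr1 ?nat1r pnatr_eq0.
rewrite sum_by_colour mulrDr mulr_sumr; congr (_ + _).
  rewrite /phi /Phi -/m -/k /A /weight -/m !natrM.
  have n1 : (0 < n - 1)%N by move: n2; lia.
  have nE : (n = (n - 1).+1)%N by move: n2; lia.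
  have := fact_mul_D (m := m) (k := k) n1; rewrite -nE => /(_ m_le (nonzero_le _)) F.
  rewrite mulrAC -[RHS]mulrAC -F; ring.
rewrite [RHS]big_mkcond; apply: eq_bigr => q _; rewrite /phi.
case: posnP => [->|Iq]; first by rewrite mul0r.
by rewrite mulrCA divff ?mulr1 // pnatr_eq0 -lt0n.
Qed.

(** The count for fixed points of colours o and o', rewritten in terms of the full profile [I]: the
    multiplicities on the other n - 2 points are lower by one for each erased point of that
    colour. *)
Definition pair_value (o o' : option T) : rat :=
  let N := (n - 2)%N in let d (l : nat) := D (m - l) k N in
  match o, o' with
  | None, None => N%:R ^+ 2 * Phi N I
  | Some q, None | None, Some q =>
      N%:R * ((n - 1 - m)`! * \prod_q (I q)`!)%N%:R / (I q)%:R
      * (((I q)%:R - 1) * d 1%N + (I q)%:R * d 0%N)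
  | Some q, Some q' =>
      if q == q' then A / ((I q)%:R * ((I q)%:R - 1))
        * (((I q)%:R - 2) ^+ 2 * d 2%N + ((I q)%:R - 1) * (2 * (I q)%:R - 3) * d 1%N
           + ((I q)%:R - 1) * (I q)%:R * d 0%N)
      else A / ((I q)%:R * (I q')%:R)
        * (((I q)%:R - 1) * ((I q')%:R - 1) * d 2%N
           + (((I q')%:R - 1) * (I q)%:R + (I q')%:R * ((I q)%:R - 1)) * d 1%N
           + (I q)%:R * (I q')%:R * d 0%N)
  end.

Lemma pair_valueE a b : a != b ->
  (\sum_(s in cyc (~: [set a])) \sum_(t in cyc (~: [set b])) sep c (s * t)%g)%N%:R
  = pair_value (c a) (c b).
Proof.
move=> ab; rewrite sep_count_neq //; set S := ~: [set a; b].
have cS : #|S| = (n - 2)%N by rewrite cardsCs setCK cards2 ab.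
have S0 : S != set0 by rewrite -card_gt0 cS; move: n2; lia.
have bT : b \in [set: T] :\ a by rewrite !inE eq_sym ab.
have SE : ([set: T] :\ a) :\ b = S by apply/setP => x; rewrite !inE negb_or andbC andbT.
have E q : I q = (profile c S q + (c b == Some q) + (c a == Some q))%N.
  by rewrite /I (profile_remove q (in_setT a)) (profile_remove q bT) SE.
have N1 (q : T) : insertion S (Some q) (fun c' => #|S| * sep_count S c')%N c
    = (#|S| * insertion S (Some q) (sep_count S) c)%N.
  by rewrite /insertion -big_distrr /= mulnCA mulnDr.
have one q : (forall q', I q' = (profile c S q' + (q' == q))%N) -> (m < n)%N ->
  (#|S| * insertion S (Some q) (sep_count S) c)%N%:R =
     (n - 2)%:R * ((n - 1 - m)`! * \prod_q (I q)`!)%N%:R / (I q)%:R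
      * (((I q)%:R - 1) * D (m - 1) k (n - 2) + (I q)%:R * D (m - 0) k (n - 2)).
  move=> {}E mn; rewrite natrM insertion1 // cS.
  set i := profile c S in E *.
  have Iq : I q = (i q).+1 by rewrite E eqxx addn1.
  have mi : m = (\sum_q i q).+1 := sum_incr E.
  rewrite /k (nonzero_incr E) (prod_incr E) /weight Iq mi !subSS !subn0.
  rewrite (_ : n - 1 - (\sum_q i q).+1 = n - 2 - \sum_q i q)%N; last by lia.
  by rewrite !natrM -!natr1; field; rewrite natr1 pnatr_eq0.
case ca: (c a) => [q|]; case cb: (c b) => [q'|].
- have {}E r : I r = (profile c S r + (r == q') + (r == q))%N.
    by rewrite E ca cb [r == q]eq_sym [r == q']eq_sym.
  rewrite insertion2 // cS; set i := profile c S in E *.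
  pose j r := (i r + (r == q'))%N.
  have Ej r : j r = (i r + (r == q'))%N by [].
  have EI r : I r = (j r + (r == q))%N by rewrite E.
  have mi : m = (\sum_q i q).+2 by rewrite /m (sum_incr EI) (sum_incr Ej).
  rewrite -Ej; set jq := j q.
  have kE : (nonzero i + (i q' == 0) + (jq == 0))%N = k.
    by rewrite /k (nonzero_incr EI) (nonzero_incr Ej).
  have AE : A = weight (n - 2) i * (jq.+1)%:R * (i q').+1%:R.
    rewrite /A /weight -/m mi (prod_incr EI) (prod_incr Ej) -/jq !natrM.
    by rewrite -subnDA add2n; ring.
  rewrite kE /pair_value AE mi !subSS !subn0.
  have Iq : I q = jq.+1 by rewrite EI eqxx addn1.
  case: (eqVneq q q') => [qq'|qq'].
    have jqE : jq = (i q').+1 by rewrite /jq /j qq' eqxx addn1.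
    rewrite Iq jqE qq' -!natr1; field.
    by rewrite addrK !natr1 !pnatr_eq0.
  have Iq' : I q' = (i q').+1 by rewrite EI Ej eqxx eq_sym (negPf qq') addn0 addn1.
  have jqE : jq = i q by rewrite /jq /j (negPf qq') addn0.
  rewrite Iq Iq' jqE -!natr1; field.
  by rewrite !natr1 !pnatr_eq0.
- rewrite [insertion _ None _ _]/= one ?(uncoloured_lt cb) // => r.
  by rewrite E ca cb addn0 [r == q]eq_sym.
- rewrite [insertion S None _]/insertion N1 one ?(uncoloured_lt ca) // => r.
  by rewrite E ca cb addn0 [r == q']eq_sym.
rewrite /= !natrM sum_sep // cS expr2 -mulrA; congr (_ * (_ * _)).
by apply: eq_Phi => r; rewrite E ca cb !addn0.
Qed.

Let N := (n - 2)%N.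
Let d (l : nat) := D (m - l) k N.
Let m1 := #|[set q | I q == 1%N]|.

(** The sums over colours below are brought into this shape, so only m, k and m1 survive in the
    result. *)
Lemma sum_used_linear (x y z : rat) :
  \sum_(q | (0 < I q)%N) (x * (I q)%:R + y + z * (I q == 1%N)%:R)
  = x * m%:R + y * k%:R + z * m1%:R :> rat.
Proof.
rewrite !big_split /= -!mulr_sumr -!natr_sum; congr (_ * _%:R + _ + _ * _%:R).
- by rewrite /m big_mkcond; apply: eq_bigr => q _; case: (I q).
- rewrite big_const iter_addr addr0 -[LHS]mulr_natr; congr (_ * _%:R).
  by apply: eq_card => q; rewrite !inE.
rewrite /m1 -sum1dep_card big_mkcond [RHS]big_mkcond; apply: eq_bigr => q _.
by case: (I q) => [|[|?]].
Qed.

Lemma pair_none_none :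
  (n - m)%N%:R * ((n - m)%N%:R - 1) * pair_value None None = A * (N%:R ^+ 2 * d 0).
Proof.
have N0 : (0 < N)%N by rewrite subn_gt0.
have nE : n = N.+2 by move: n2; rewrite /N; lia.
rewrite /pair_value /Phi -/N -/m -/k /A /weight -/m /d subn0 !natrM.
(* For m = n there is no uncoloured point, and [D] vanishes on the right. *)
have := m_le; rewrite leq_eqVlt => /predU1P[mE|].
  by rewrite mE nE D_eq0_succ2 ?mulr0 // -nE -mE nonzero_le.
rewrite nE ltnS => mN; have F := fact_mul_D N0 mN (nonzero_le I); rewrite -/m -/k in F.
rewrite (subSn mN) factS natrM -natr1 addrK.
transitivity ((N.+1 - m)%N.+1%:R * (\prod_q (I q)`!)%:R * N%:R ^+ 2
  * ((N.+1 - m)%N%:R * ((N - m)`!%:R * D m k N))); first by rewrite -natr1; ring.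
by rewrite F -natr1; ring.
Qed.

Lemma pair_some_none q : (0 < I q)%N ->
  (n - m)%N%:R * (I q)%:R * pair_value (Some q) None
  = A * (N%:R * (((I q)%:R - 1) * d 1 + (I q)%:R * d 0)).
Proof.
move=> Iq; have N0 : (0 < N)%N by rewrite subn_gt0.
have nE : n = N.+2 by move: n2; rewrite /N; lia.
have Iq0 : (I q)%:R != 0 :> rat by rewrite pnatr_eq0 -lt0n.
rewrite /pair_value -/N /A /weight -/m /d; have := m_le; rewrite leq_eqVlt => /predU1P[mE|mn].
  (* With m = n the left side has the factor 0, and both values of [D] on the right vanish. *)
  have km : (k <= m)%N := nonzero_le _.
  have -> : D (m - 0) k N = 0 by rewrite subn0 mE nE D_eq0_succ2 // -nE -mE.
  have -> : D (m - 1) k N = 0.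
    rewrite mE nE subSS subn0; rewrite mE nE in km.
    case: (leqP k N.+1) => kN; first by rewrite D_eq0_succ.
    by rewrite D_eq0_outside.
  by rewrite !(mulr0, addr0).
rewrite subnAC -[(n - m)%N in RHS]prednK ?subn_gt0 // factS subn1 prednK ?subn_gt0 //.
by rewrite !natrM; field.
Qed.

Lemma pair_none_some q : pair_value None (Some q) = pair_value (Some q) None.
Proof. by []. Qed.

(** For I q = 1 no two distinct points have colour q and the left side is 0, while (I q - 2)^2 is 1;
    the indicator corrects this. It is the source of -m1 in the last coefficient of the theorem. *)
Lemma pair_same q : (0 < I q)%N ->
  (I q)%:R * ((I q)%:R - 1) * pair_value (Some q) (Some q)
  = A * ((((I q)%:R - 2) ^+ 2 - (I q == 1%N)%:R) * d 2
         + ((I q)%:R - 1) * (2 * (I q)%:R - 3) * d 1 + ((I q)%:R - 1) * (I q)%:R * d 0).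
Proof.
rewrite /pair_value eqxx -/N -/(d 0) -/(d 1) -/(d 2).
case: (I q) => [|[|r]] // _; first by rewrite eqxx /= subrr mulr0 !mul0r; ring.
rewrite /= subr0 -!natr1; field.
by rewrite addrK !natr1 !pnatr_eq0.
Qed.

Lemma pair_different q q' : (0 < I q)%N -> (0 < I q')%N -> q != q' ->
  (I q)%:R * (I q')%:R * pair_value (Some q) (Some q')
  = A * (((I q)%:R - 1) * ((I q')%:R - 1) * d 2
           + (((I q')%:R - 1) * (I q)%:R + (I q')%:R * ((I q)%:R - 1)) * d 1
           + (I q)%:R * (I q')%:R * d 0).
Proof.
move=> Iq Iq' /negPf qq'; rewrite /pair_value qq' -/N -/(d 0) -/(d 1) -/(d 2).
by field; rewrite !pnatr_eq0 -!lt0n Iq Iq'.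
Qed.

Lemma sum_pair_neq :
  \sum_a \sum_(b | b != a) pair_value (c a) (c b)
  = A * (((n%:R + m%:R - 2) ^+ 2 - m%:R) * d 0
  + (m%:R - k%:R) * (2 * n%:R + 2 * m%:R - 7) * d 1
  + ((m%:R - k%:R - 2) * (m%:R - k%:R) + k%:R - m1%:R) * d 2).
Proof.
(* The sum over b distinct from a is the sum over all b minus the diagonal term, and both depend
   only on the colour of a. *)
pose phi o := \sum_b pair_value o (c b) - pair_value o o.
rewrite (eq_bigr (fun a => phi (c a))) => [|a _]; last first.
  by rewrite /phi [in RHS](bigD1 a) //= addrC addrK.
have NE : N%:R = n%:R - 2 :> rat by rewrite natrB // ltnW.
have X1 : (n - m)%N%:R * phi None
    = A * (N%:R ^+ 2 * d 0 + N%:R * ((m%:R - k%:R) * d 1 + m%:R * d 0)).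
  rewrite /phi sum_by_colour addrAC mulrDr.
  have -> : (n - m)%N%:R * ((n - m)%N%:R * pair_value None None - pair_value None None)
     = (n - m)%N%:R * ((n - m)%N%:R - 1) * pair_value None None by ring.
  rewrite pair_none_none mulrDr; congr (_ + _); rewrite mulr_sumr.
  transitivity (\sum_(q | (0 < I q)%N) (A * N%:R * (d 1 + d 0) * (I q)%:R
      + - (A * N%:R * d 1) + 0 * (I q == 1%N)%:R)).
    rewrite [RHS]big_mkcond; apply: eq_bigr => q _.
    case: posnP => [->|Iq]; first by rewrite mul0r mulr0.
    by rewrite pair_none_some mulrA pair_some_none //; ring.
  by rewrite sum_used_linear; ring.
have X2 q : (0 < I q)%N -> (I q)%:R * phi (Some q)
  = A * (((m%:R - k%:R - 2) * d 2 + (N%:R + 2 * m%:R - k%:R - 3 + N%:R - N%:R) * d 1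
      + (N%:R + m%:R - 1) * d 0) * (I q)%:R
      + ((3 - (m%:R - k%:R)) * d 2 + (3 - m%:R - N%:R) * d 1) + - d 2 * (I q == 1%N)%:R).
  move=> Iq; rewrite /phi sum_by_colour -addrA mulrDr mulrA [_ * (n - m)%N%:R]mulrC.
  rewrite pair_some_none //.
  have Y : \sum_q0 (I q0)%:R * pair_value (Some q) (Some q0)
     = \sum_(q0 | (0 < I q0)%N) (I q0)%:R * pair_value (Some q) (Some q0).
    by rewrite [RHS]big_mkcond; apply: eq_bigr => q0 _; case: posnP => // ->; rewrite mul0r.
  rewrite Y (bigD1 q) //=.
  have Z : (I q)%:R * (\sum_(q0 | (0 < I q0)%N && (q0 != q))
        (I q0)%:R * pair_value (Some q) (Some q0))
    = A * (m%:R * (((I q)%:R - 1) * d 2 + (2 * (I q)%:R - 1) * d 1 + (I q)%:R * d 0)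
        - k%:R * (((I q)%:R - 1) * d 2 + (I q)%:R * d 1)
        - ((((I q)%:R - 1) ^+ 2) * d 2 + 2 * (I q)%:R * ((I q)%:R - 1) * d 1
           + (I q)%:R ^+ 2 * d 0)).
    (* The contribution of the colour q0 is affine in I q0, so the sum over q0 other than q is the
       full sum minus [Yq q]. *)
    pose Yq (q0 : T) := A * (((I q)%:R - 1) * d 2 + (2 * (I q)%:R - 1) * d 1 + (I q)%:R * d 0)
        * (I q0)%:R + - (A * (((I q)%:R - 1) * d 2 + (I q)%:R * d 1)) + 0 * (I q0 == 1%N)%:R.
    transitivity (\sum_(q0 | (0 < I q0)%N) Yq q0 - Yq q).
      rewrite [in RHS](bigD1 q) //= [RHS]addrAC subrr add0r mulr_sumr; apply: eq_bigr => q0 /andP[I0 q0q].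
      by rewrite mulrA pair_different // 1?eq_sym // /Yq; ring.
    by rewrite sum_used_linear /Yq; ring.
  have E (x y p z : rat) : x + z * (z * p + y - p) = x + z * y + z * (z - 1) * p by ring.
  by rewrite E Z pair_same //; ring.
rewrite sum_by_colour X1.
have -> : \sum_q (I q)%:R * phi (Some q) = \sum_(q | (0 < I q)%N) (I q)%:R * phi (Some q).
  by rewrite [RHS]big_mkcond; apply: eq_bigr => q _; case: posnP => // ->; rewrite mul0r.
rewrite (eq_bigr _ X2) -mulr_sumr sum_used_linear NE.
by ring.
Qed.

End Totals.
End Evaluate.

(** * Cycle types and blocks *)

Section CycleType.
Local Open Scope nat_scope.
Variable n : nat.
Hypothesis n2 : (2 < n)%N.
Implicit Types (s t : 'S_n) (a b x y : 'I_n).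

Lemma cards_setC1 a : #|~: [set a]| = n.-1.
Proof. by rewrite cardsCs setCK cards1 card_ord subn1. Qed.

(** As n > 2, the lengths n - 1 and 1 differ, so the orbit of length n - 1 misses the fixed point a
    and is its whole complement. *)
Lemma perms_of_typeP s :
  reflect (exists a, s \in cyc (~: [set a])) (s \in perms_of_type n [:: (n - 1)%N; 1%N]).
Proof.
have tot : total geq by move=> x y; apply: leq_total.
have tr : transitive geq by move=> x y z xy yz; apply: leq_trans xy.
have asym : antisymmetric geq by move=> x y; rewrite andbC => /anti_leq.
have n1 : 1 != n - 1 by move: n2; lia.
rewrite inE /cycle_type; apply: (iffP eqP) => [E|[a sa]].
  have pE : perm_eq [seq #|C| | C : {set 'I_n} in porbits s] [:: n - 1; 1].
    by rewrite -E perm_sym perm_sort.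
  have mem u : u \in [:: n - 1; 1] -> exists z, #|porbit s z| = u.
    rewrite -(perm_mem pE) => /imageP[C /imsetP[z _ ->] ->]; by exists z.
  have [a aE] := mem 1 (mem_last _ [:: 1]).
  have [z zE] := mem (n - 1) (mem_head _ _).
  have aO : porbit s a = [set a].
    by apply/esym/eqP; rewrite eqEcard sub1set porbit_id cards1 aE.
  have az : a \notin porbit s z.
    by apply: contra n1; rewrite -eq_porbit_mem -zE -aE => /eqP->.
  have zO : porbit s z = ~: [set a].
    apply/eqP; rewrite eqEcard cards_setC1 zE subn1 leqnn andbT.
    by apply/subsetP => x xz; rewrite !inE; apply: contraNneq az => <-.
  have sfix : s a = a by apply/eqP; rewrite -in_set1 -aO porbit_step.
  exists a; apply/cycP; split.
    by rewrite inE; apply/subsetP => x; rewrite !inE; apply: contraNneq => ->; rewrite sfix.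
  by move=> x y; rewrite -zO => xz; apply: porbit_trans; rewrite porbit_sym.
have [sS sc] := cycP _ _ sa.
have sfix : s a = a by rewrite (Sym_id sS) // !inE eqxx.
have Oa : porbit s a = [set a].
  apply/setP => y; rewrite in_set1; apply/idP/eqP => [/(porbit_fix sfix)//|->].
  exact: porbit_id.
have Ox x : x != a -> porbit s x = ~: [set a].
  move=> xa; have xS : x \in ~: [set a] by rewrite !inE.
  apply/setP => y; apply/idP/idP => [yx|yS]; last exact: sc.
  rewrite !inE; apply: contra xa => /eqP ya; move: yx; rewrite ya porbit_sym.
  by move/(porbit_fix sfix)/eqP.
have [z za] : exists z, z \in ~: [set a].
  by apply/card_gt0P; rewrite cards_setC1; move: n2; lia.
have zE : z != a by rewrite !inE in za.
have -> : [:: n - 1; 1] = sort geq [:: n - 1; 1].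
  by apply/esym/sorted_sort => //=; rewrite andbT /geq /=; move: n2; lia.
apply/(perm_sortP tot tr asym).
have -> : [:: n - 1; 1] = [seq #|(C : {set 'I_n})| | C <- [:: ~: [set a]; [set a]]].
  by rewrite /= cards1 (cards_setC1 a) subn1.
apply: perm_map; apply: uniq_perm; first exact: enum_uniq.
  rewrite /= andbT inE; apply: contra n1 => /eqP E.
  by rewrite subn1 -(cards_setC1 a) E cards1.
move=> C; rewrite mem_enum !inE; apply/imsetP/orP => [[x _ ->]|[/eqP->|/eqP->]].
- by have [->|xa] := eqVneq x a; [right; rewrite Oa | left; rewrite Ox].
- by exists z; rewrite ?Ox.
by exists a; rewrite ?Oa.
Qed.

(** If a and b differed, a third point would lie on a common cycle with a, although a is fixed. *)
Lemma cyc_setC1_inj s a b : s \in cyc (~: [set a]) -> s \in cyc (~: [set b]) -> a = b.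
Proof.
case/cycP => sa _ /cycP[_ sb]; apply/eqP; apply: contraT => ab.
have sfix : s a = a by rewrite (Sym_id sa) // !inE eqxx.
have [z zab] : exists z, z \in ~: [set a; b].
  by apply/card_gt0P; have := cardsC [set a; b]; rewrite cards2 ab card_ord; move: n2; lia.
move: zab; rewrite !inE negb_or => /andP[za zb].
have := sb a z; rewrite !inE => /(_ ab zb) /(porbit_fix sfix) E.
by rewrite E eqxx in za.
Qed.

Lemma sum_perms_of_type (phi : 'S_n -> nat) :
  \sum_(s in perms_of_type n [:: (n - 1)%N; 1%N]) phi s
  = \sum_a \sum_(s in cyc (~: [set a])) phi s.
Proof.
rewrite (exchange_big_dep (fun s => s \in perms_of_type n [:: (n - 1)%N; 1%N])) /=.
  apply: eq_bigr => s /perms_of_typeP[a sa].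
  rewrite (big_pred1 a) // => b; apply/idP/eqP => [sb|-> //].
  exact: cyc_setC1_inj sb sa.
by move=> a s _ sa; apply/perms_of_typeP; exists a.
Qed.

Lemma card_perms_of_type : #|perms_of_type n [:: (n - 1)%N; 1%N]| = n * (n - 2)`!.
Proof.
rewrite -sum1_card sum_perms_of_type.
under eq_bigr do rewrite sum1_card card_cyc cards_setC1.
by rewrite sum_nat_const card_ord subn2.
Qed.
End CycleType.

(** * The colouring given by the blocks of a composition *)

Section Blocks.
Local Open Scope nat_scope.
Variables (n m k : nat) (I : seq nat).
Hypotheses (hI : is_composition I m) (hk : size I = k).
Hypotheses (hkn : (k <= n)%N) (hmn : (m <= n)%N).

Lemma sumn_take_mono p q : p <= q -> sumn (take p I) <= sumn (take q I).
Proof.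
by move=> pq; rewrite -(subnKC pq) takeD sumn_cat leq_addr.
Qed.

Lemma block_inj (p q : 'I_(size I)) (x : 'I_n) : x \in block n p -> x \in block n q -> p = q.
Proof.
rewrite !inE => /andP[p1 p2] /andP[q1 q2]; apply/val_inj => /=.
case: (ltngtP p q) => // pq; have := sumn_take_mono pq.
  by move/leq_trans/(_ q1); rewrite leqNgt p2.
by move/leq_trans/(_ p1); rewrite leqNgt q2.
Qed.

Lemma card_block (p : 'I_(size I)) : #|block n p| = nth 0 I p.
Proof.
have [_ /eqP mE] := andP hI.
rewrite /block -sum1dep_card.
have := @sumn_take_mono p.+1 (size I) (ltn_ord p); rewrite take_size mE => le2.
have E : sumn (take p.+1 I) = sumn (take p I) + nth 0 I p.
  by rewrite (take_nth 0) // sumn_rcons.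
transitivity (\sum_(sumn (take p I) <= i < sumn (take p.+1 I)) 1).
  by rewrite (big_nat_widen _ _ n) ?(leq_trans le2) // (big_nat_widenl _ 0) // big_mkord; apply: eq_bigl => x; rewrite andbC.
by rewrite sum_nat_const_nat muln1 E addKn.
Qed.

(** Colours must be elements of the ground set; since k <= n, the index of a block can serve as its
    colour. *)
Definition block_label (p : 'I_(size I)) : 'I_n := widen_ord (leq_trans (eq_leq hk) hkn) p.

Definition block_colour (x : 'I_n) : option 'I_n :=
  omap block_label [pick p : 'I_(size I) | x \in block n p].

Lemma block_label_inj : injective block_label.
Proof. by move=> p q /(congr1 val) /= /val_inj. Qed.

Lemma block_colourP x p : (block_colour x == Some (block_label p)) = (x \in block n p).
Proof.
rewrite /block_colour; case: pickP => [q xq|H] /=; last by rewrite H.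
apply/eqP/idP => [/(congr1 (odflt (block_label q)))/= /block_label_inj <- //|xp].
by rewrite (block_inj xq xp).
Qed.

Lemma block_colour_some x q : block_colour x = Some q ->
  exists2 p, q = block_label p & x \in block n p.
Proof. by rewrite /block_colour; case: pickP => //= p xp [<-]; exists p. Qed.

Lemma separatedE s : separated I s = sep block_colour s.
Proof.
apply/forall_inP/sepP => [H x y yx|H C /imsetP[z _ ->]].
  case cx : (block_colour x) => [q|] // _; case cy : (block_colour y) => [q'|] // _.
  have [p -> xp] := block_colour_some cx; have [p' -> yp] := block_colour_some cy.
  have xO : porbit s x \in porbits s by apply: imset_f.
  have /forall_inP/(_ x (porbit_id _ _))/forall_inP/(_ y yx) := H _ xO.
  by move=> /forallP/(_ p)/forallP/(_ p'); rewrite xp yp => /eqP->.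
apply/forall_inP => x xz; apply/forall_inP => y yz.
apply/forallP => p; apply/forallP => q; apply/implyP => /andP[].
rewrite -!block_colourP => /eqP xp /eqP yq; apply/eqP/block_label_inj.
have yx : y \in porbit s x by apply: porbit_trans yz; rewrite porbit_sym.
have := H x y yx; rewrite xp yq => /(_ isT isT).
by move/(congr1 (odflt (block_label p))).
Qed.

Lemma profile_block q : profile block_colour [set: 'I_n] q = nth 0 I q.
Proof.
have [qI|qI] := ltnP q (size I).
  have -> : q = block_label (Ordinal qI) by apply: val_inj.
  rewrite -(card_block (Ordinal qI)); apply: eq_card => x.
  by rewrite !in_set andTb block_colourP !inE.
rewrite nth_default //; apply/eqP; rewrite cards_eq0; apply/eqP/setP => x.
rewrite !inE /=; apply/negP => /eqP/block_colour_some[p qp _].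
by move: qI; rewrite qp leqNgt (ltn_ord p).
Qed.

(** Colours that label no block have profile 0 and contribute the unit. The statistics m, k, m1 and
    the product of factorials are instances. *)
Lemma big_profile (R : Type) (idx : R) (op : Monoid.com_law idx) (F : nat -> R) :
  F 0 = idx ->
  \big[op/idx]_q F (profile block_colour [set: 'I_n] q) = \big[op/idx]_(i <- I) F i.
Proof.
move=> F0; under eq_bigr do rewrite profile_block.
rewrite -(big_mkord predT (fun q => F (nth 0 I q))).
rewrite (@big_cat_nat _ _ _ (size I)) ?hk //= -hk -(big_nth 0 predT).
rewrite [X in op _ X]big1_seq ?Monoid.mulm1 // => q.
by rewrite mem_index_iota => /andP[_ /andP[qI _]]; rewrite nth_default.
Qed.

Lemma sum_profile_block : \sum_q profile block_colour [set: 'I_n] q = m.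
Proof. by rewrite (@big_profile _ _ _ id) // -sumnE; case/andP: hI => _ /eqP. Qed.

Lemma prod_profile_block :
  \prod_q (profile block_colour [set: 'I_n] q)`! = \prod_(i <- I) i`!.
Proof. exact: (@big_profile _ _ _ factorial). Qed.

Lemma nonzero_profile_block : nonzero (profile block_colour [set: 'I_n]) = k.
Proof.
rewrite /nonzero -sum1dep_card big_mkcond (@big_profile _ _ _ (fun i => if 0 < i then 1 else 0)) //.
rewrite -hk -sum1_size; apply: eq_big_seq => i iI.
by case/andP: hI => /allP/(_ i iI) ->.
Qed.

Lemma ones_profile_block :
  #|[set q | profile block_colour [set: 'I_n] q == 1]| = m1 I.
Proof.
rewrite -sum1dep_card big_mkcond (@big_profile _ _ _ (fun i => if i == 1 then 1 else 0)) //.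
by rewrite -big_mkcond sum1_count.
Qed.
End Blocks.

(* Subtractions inside the arguments of D are on nat. Whenever one of them
   truncates, or the first argument drops below the second, the coefficient of
   that value of D is 0. The coefficients are computed in rat. For n <= 2 the
   right-hand side is undefined, as D _ _ 0 involves (-1)!. *)
Theorem theorem6p11 (n m k : nat) (I : seq nat)
    (hn : (2 < n)%N) (hI : is_composition I m) (hk : size I = k)
    (hkn : (k <= n)%N) (hmn : (m <= n)%N) :
  separation_probability n I [:: (n - 1)%N; 1%N] [:: (n - 1)%N; 1%N] =
  ((n - m)`! * \prod_(i <- I) i`!)%N%:R / (n%:R ^+ 2 * (n - 2)`!%:R ^+ 2) *
  ( (k%:R - (m1 I)%:R) * D (m - 1) k (n - 1)
  + (m1 I)%:R * D (m - 1) (k - 1) (n - 1)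
  + D m k (n - 1)
  + ((n%:R + m%:R - 2) ^+ 2 - m%:R) * D m k (n - 2)
  + (m%:R - k%:R) * (2 * n%:R + 2 * m%:R - 7) * D (m - 1) k (n - 2)
  + ((m%:R - k%:R - 2) * (m%:R - k%:R) + k%:R - (m1 I)%:R)
      * D (m - 2) k (n - 2)).
Proof.
set P := perms_of_type n [:: (n - 1)%N; 1%N].
pose c := block_colour hk hkn.
have hT : (2 < #|'I_n|)%N by rewrite card_ord.
have AE : weight n (profile c [set: 'I_n]) = ((n - m)`! * \prod_(i <- I) i`!)%N%:R.
  by rewrite /weight (sum_profile_block hI hk hkn hmn) (prod_profile_block hI hk hkn hmn).
(* Each permutation of this type is a long cycle on the complement of exactly one point; pairs are
   sorted by their fixed points a and b. *)
have cnt : #|[set st in setX P P | separated I (st.1 * st.2)%g]|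
    = (\sum_a \sum_b \sum_(s in cyc (~: [set a])) \sum_(t in cyc (~: [set b]))
         sep c (s * t)%g)%N.
  transitivity (\sum_(s in P) \sum_(t in P) sep c (s * t)%g)%N.
    rewrite pair_big_dep /= -sum1dep_card [RHS]big_mkcond [LHS]big_mkcond /=.
    apply: eq_bigr => -[s t] _; rewrite in_setX /= (separatedE hk hkn) -/c.
    by case: ((s \in P) && (t \in P)); case: (sep c (s * t)%g).
  etransitivity; first exact: (sum_perms_of_type hn (fun s => (\sum_(t in P) sep c (s * t)%g)%N)).
  apply: eq_bigr => a _; rewrite [RHS]exchange_big; apply: eq_bigr => s _.
  exact: (sum_perms_of_type hn).
have cntE : #|[set st in setX P P | separated I (st.1 * st.2)%g]|%:R
  = ((n - m)`! * \prod_(i <- I) i`!)%N%:R * (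
    (k%:R - (m1 I)%:R) * D (m - 1) k (n - 1)
  + (m1 I)%:R * D (m - 1) (k - 1) (n - 1)
  + D m k (n - 1)
  + ((n%:R + m%:R - 2) ^+ 2 - m%:R) * D m k (n - 2)
  + (m%:R - k%:R) * (2 * n%:R + 2 * m%:R - 7) * D (m - 1) k (n - 2)
  + ((m%:R - k%:R - 2) * (m%:R - k%:R) + k%:R - (m1 I)%:R)
      * D (m - 2) k (n - 2)) :> rat.
  have E1 := sum_sep_eq c hT; have E2 := sum_pair_neq c hT.
  have L := sum_used_linear c.
  rewrite card_ord (sum_profile_block hI hk hkn hmn) (nonzero_profile_block hI hk hkn hmn) ?(ones_profile_block hI hk hkn hmn) ?AE in E1 E2 L.
  (* The second index is k - 1 for blocks of size 1 and k otherwise, hence the summand is affine in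
     the indicator of size 1. *)
  have E3 : \sum_(q | (0 < profile c [set: 'I_n] q)%N)
       D (m - 1) (k - (profile c [set: 'I_n] q == 1%N)) (n - 1)
      = (k%:R - (m1 I)%:R) * D (m - 1) k (n - 1) + (m1 I)%:R * D (m - 1) (k - 1) (n - 1).
    transitivity (\sum_(q | (0 < profile c [set: 'I_n] q)%N)
       (0 * (profile c [set: 'I_n] q)%:R + D (m - 1) k (n - 1)
        + (D (m - 1) (k - 1) (n - 1) - D (m - 1) k (n - 1)) * (profile c [set: 'I_n] q == 1%N)%:R)).
      apply: eq_bigr => q _; case: eqP => _ /=; rewrite ?subn0; ring.
    by rewrite L; ring.
  rewrite cnt.
  (* Equal fixed points yield the values of [D] at n - 1, distinct ones those at n - 2. *)
  have -> : (\sum_a \sum_b \sum_(s in cyc (~: [set a])) \sum_(t in cyc (~: [set b])) sep c (s * t)%g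
    = \sum_a sep_count (~: [set a]) c + \sum_a \sum_(b | b != a)
       \sum_(s in cyc (~: [set a])) \sum_(t in cyc (~: [set b])) sep c (s * t)%g)%N.
    by rewrite -big_split /=; apply: eq_bigr => a _; rewrite (bigD1 a).
  rewrite natrD E1 E3 natr_sum.
  have -> : \sum_a (\sum_(b | b != a) \sum_(s in cyc (~: [set a]))
      \sum_(t in cyc (~: [set b])) sep c (s * t)%g)%N%:R
     = \sum_a \sum_(b | b != a) pair_value c (c a) (c b).
    apply: eq_bigr => a _; rewrite natr_sum; apply: eq_bigr => b ba.
    by rewrite pair_valueE // eq_sym.
  by rewrite E2 subn0; ring.
rewrite /separation_probability cntE card_perms_of_type // natrM.
by field; rewrite !pnatr_eq0 -!lt0n fact_gt0 (ltn_trans _ hn).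
Qed.
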